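(* Let $R=k[x_1,\ldots,x_n]$ be a polynomial ring over a field $k$ with homogeneous maximal ideal $\mathfrak m$, let $2\le r\le n$, and let $f_1,\ldots,f_r$ be a homogeneous regular sequence in $R$ of degrees $d_1\ge\cdots\ge d_r$. Let $d\ge d_1$ be an integer, put $a_i=d-d_i$, $M=\mathfrak m^{a_1}\oplus\cdots\oplus\mathfrak m^{a_r}$, and $I=(f_1,\ldots,f_r)_{\ge d}=\mathfrak m^{a_1}f_1+\cdots+\mathfrak m^{a_r}f_r$. With the notation of the context: (a) If $d\ge d_1+d_2$, then $\mathcal F(I)=\mathcal F(M)/(h_1,\ldots,h_t)=T/(I_2(B),h_1,\ldots,h_t)$, where each $T_{l,\underline j}$ maps to the class of $\underline x^{a_l,\underline j}f_lt$ in $\mathcal F(I)$. (b) If $r=2$ and $d_1\le d\le d_1+d_2-1$, then, with $\delta=d_1+d_2-d$, $\mathcal F(I)=A/\mathcal K$ for an ideal $\mathcal K$ of $A=T/I_2(B)$ which, as a graded $A$-module, is isomorphic to $K^{(\delta)}(-1)$.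
   Context: For an integer $a\ge 0$ let $\mathcal J_a$ be the set of multi-indices $\underline j=(j_{n-1},\ldots,j_1)$ of integers with $0\le j_1\le\cdots\le j_{n-1}\le a$, and let $\mathcal J'_a$ be the subset of those with $1\le j_1$ (so $\mathcal J'_0=\emptyset$). For $\underline j\in\mathcal J_a$ put $\underline x^{a,\underline j}=\prod_{i=1}^n x_i^{j_i-j_{i-1}}$, where $j_0=0$, $j_n=a$ (these are the monomials of degree $a$). $\mathcal F(I)=\mathcal R(I)\otimes_R k=R[It]/\mathfrak mR[It]$ is the special fiber ring of $I$. The special fiber ring of $M$ is $\mathcal F(M)=k[\{\underline x^{a_l,\underline j}t_l : 1\le l\le r,\ \underline j\in\mathcal J_{a_l}\}]\subset R[t_1,\ldots,t_r]$. Let $T=k[T_{l,\underline j} : 1\le l\le r,\ \underline j\in\mathcal J_{a_l}]$ be a polynomial ring with the standard grading ($\deg T_{l,\underline j}=1$), mapping onto $\mathcal F(M)$ by $T_{l,\underline j}\mapsto\underline x^{a_l,\underline j}t_l$. For $\underline j\in\mathcal J'_{a_l}$ and $1\le s\le n$ let $T_{l,\underline j,s}$ denote the variable $T_{l,(j_{n-1},\ldots,j_s,\,j_{s-1}-1,\ldots,j_1-1)}$. Let $B$ be the matrix with $n$ rows, with columns indexed by the pairs $(l,\underline j)$, $1\le l\le r$, $\underline j\in\mathcal J'_{a_l}$, ordered lexicographically, whose entry in row $s$ and column $(l,\underline j)$ is $T_{l,\underline j,s}$. $I_2(B)$ is the $T$-ideal generated by the $2\times 2$ minors of $B$, and $A=T/I_2(B)$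 (which is identified with $\mathcal F(M)$ via the map induced by the $k$-algebra epimorphism $T\to\mathcal F(M)$, $T_{l,\underline j}\mapsto\underline x^{a_l,\underline j}t_l$, whose kernel is $I_2(B)$). $K$ is the (prime) ideal of $A$ generated by the images of all the variables in the first row of $B$, i.e. all $T_{l,\underline j}$ with $1\le l\le r$ and $\underline j\in\mathcal J'_{a_l}$; for $\delta\ge1$, $K^{(\delta)}=K^{\delta}A_K\cap A$ is its $\delta$-th symbolic power. For $d\ge d_1+d_2$, the linear forms $h_1,\ldots,h_t\in T$ are defined as follows. For each pair $1\le i<j\le r$ and each monomial $m$ in $R$ of degree $d-d_i-d_j\ge 0$, write $mf_j=\sum_{\underline k\in\mathcal J_{a_i}}c_{\underline k}\,\underline x^{a_i,\underline k}$ and $mf_i=\sum_{\underline k\in\mathcal J_{a_j}}b_{\underline k}\,\underline x^{a_j,\underline k}$ with $c_{\underline k},b_{\underline k}\in k$; the corresponding linear form is $-\sum_{\underline k\in\mathcal J_{a_i}}c_{\underline k}T_{i,\underline k}+\sum_{\underline k\in\mathcal J_{a_j}}b_{\underline k}T_{j,\underline k}$. Listing all of them gives $h_1,\ldots,h_t$ with $t=\sum_{1\le i<j\le r}\binom{d-d_i-d_j+n-1}{n-1}$. *)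

(* Defs.v *)
From HB Require Import structures.
From mathcomp Require Import all_boot all_order all_algebra.
From mathcomp Require Import generic_quotient ring_quotient.
From mathcomp Require Import boolp classical_sets functions.
From mathcomp Require Import mpoly.

Set Implicit Arguments.
Unset Strict Implicit.
Unset Printing Implicit Defensive.

Import GRing.Theory.
Local Open Scope ring_scope.
Local Open Scope classical_set_scope.

Record ideal (S : comPzRingType) := Ideal {
  ideal_set :> S -> Prop;
  ideal_set0 : ideal_set 0;
  ideal_setMD : forall a x y, ideal_set x -> ideal_set y -> ideal_set (a * x + y) }.

Definition ideal_pred (S : comPzRingType) (I : ideal S) : {pred S} :=
  fun x => `[< I x >].

Section IdealQuotient.
Variables (S : comPzRingType) (I : ideal S).

Lemma ideal_predE x : (x \in ideal_pred I) = `[< I x >].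
Proof. by []. Qed.

Lemma idealM a x : I x -> I (a * x).
Proof.
by move=> Ix; rewrite -[a * x]addr0; apply: ideal_setMD Ix (ideal_set0 I).
Qed.

Lemma idealD x y : I x -> I y -> I (x + y).
Proof. by move=> Ix Iy; rewrite -[x]mul1r; apply: ideal_setMD. Qed.

Lemma ideal_sum (J : Type) (s : seq J) (P : pred J) (F : J -> S) :
  (forall i, P i -> I (F i)) -> I (\sum_(i <- s | P i) F i).
Proof.
by move=> IF; elim/big_ind: _ => //; [exact: ideal_set0 | exact: idealD].
Qed.

Lemma ideal_zmod_closed : zmod_closed (ideal_pred I).
Proof.
split; first by apply/asboolP; exact: ideal_set0.
move=> x y /asboolP Ix /asboolP Iy; apply/asboolP.
by rewrite addrC -mulN1r; apply: ideal_setMD.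
Qed.

HB.instance Definition _ :=
  GRing.isZmodClosed.Build S (ideal_pred I) ideal_zmod_closed.

(* [ideal_quot] of the library asks for proper ideals of nontrivial rings;
   here the ideal may be the whole ring. *)
Definition qring : Type := Quotient.quot (ideal_pred I).

HB.instance Definition _ := GRing.Zmodule.on qring.

Definition cls (x : S) : qring := \pi_(Quotient.quot (ideal_pred I))%qT x.

Lemma clsE x y : cls x = cls y <-> I (x - y).
Proof.
rewrite /cls; split=> [/eqP|Ixy].
  by rewrite -Quotient.idealrBE => /asboolP.
by apply/eqP; rewrite -Quotient.idealrBE; apply/asboolP.
Qed.

Lemma cls_surj (q : qring) : exists x, cls x = q.
Proof. by exists (repr q); exact: reprK. Qed.

Lemma clsD x y : cls (x + y) = cls x + cls y.
Proof. exact: raddfD. Qed.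

Lemma clsB x y : cls (x - y) = cls x - cls y.
Proof. exact: raddfB. Qed.

Definition qring_repr (q : qring) : S := @repr S (Quotient.quot (ideal_pred I)) q.
Lemma qring_reprK q : cls (qring_repr q) = q. Proof. exact: reprK. Qed.

Definition qring_one : qring := cls 1.
Definition qring_mul (p q : qring) : qring := cls (qring_repr p * qring_repr q).

Lemma cls_mul x y : cls (x * y) = qring_mul (cls x) (cls y).
Proof.
apply/clsE; set x' := qring_repr _; set y' := qring_repr _.
have Ix : I (x - x') by apply/clsE; rewrite qring_reprK.
have Iy : I (y - y') by apply/clsE; rewrite qring_reprK.
have -> : x * y - x' * y' = y * (x - x') + x' * (y - y').
  by rewrite !mulrBr [y * x]mulrC [y * x']mulrC addrA subrK.
by apply: ideal_setMD => //; apply: idealM.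
Qed.

Fact qring_mulA : associative qring_mul.
Proof.
move=> p q s; rewrite -[p]qring_reprK -[q]qring_reprK -[s]qring_reprK.
by rewrite -!cls_mul mulrA.
Qed.

Fact qring_mulC : commutative qring_mul.
Proof. by move=> p q; rewrite /qring_mul mulrC. Qed.

Fact qring_mul1 : left_id qring_one qring_mul.
Proof. by move=> p; rewrite -[p]qring_reprK -cls_mul mul1r. Qed.

Fact qring_mulDl : left_distributive qring_mul +%R.
Proof.
move=> p q s; rewrite -[p]qring_reprK -[q]qring_reprK -[s]qring_reprK.
by rewrite -!(cls_mul, clsD) mulrDl.
Qed.

HB.instance Definition _ := GRing.Zmodule_isComPzRing.Build qring
  qring_mulA qring_mulC qring_mul1 qring_mulDl.

Fact cls_zmod_morphism : zmod_morphism cls. Proof. exact: clsB. Qed.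
Fact cls_monoid_morphism : monoid_morphism cls.
Proof. by split=> // x y; exact: cls_mul. Qed.
HB.instance Definition _ := GRing.isZmodMorphism.Build S qring cls cls_zmod_morphism.
HB.instance Definition _ := GRing.isMonoidMorphism.Build S qring cls cls_monoid_morphism.

End IdealQuotient.

Section IdealGen.
Variable S : comPzRingType.

Definition ideal_gen_set (X : set S) : set S :=
  [set x | forall J : ideal S, X `<=` J -> J x].

Fact ideal_gen0 X : ideal_gen_set X 0.
Proof. by move=> J _; exact: ideal_set0. Qed.

Fact ideal_genMD X a x y :
  ideal_gen_set X x -> ideal_gen_set X y -> ideal_gen_set X (a * x + y).
Proof. by move=> Xx Xy J XJ; apply: ideal_setMD; [apply: Xx | apply: Xy]. Qed.

Definition ideal_gen (X : set S) : ideal S := Ideal (@ideal_gen0 X) (@ideal_genMD X).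

Lemma sub_ideal_gen X : X `<=` ideal_gen X.
Proof. by move=> x Xx J XJ; apply: XJ. Qed.

Fixpoint ideal_pow (I : ideal S) (e : nat) : ideal S :=
  if e is e'.+1
  then ideal_gen [set x | exists y z, [/\ I y, ideal_pow I e' z & x = y * z]]
  else ideal_gen [set 1].

(* K^e A_K `&` A for a prime ideal K of a ring A: the elements a such that
   a / 1 = b / s in A_K for some b in K^e and some s outside K; equality of
   fractions in A_K means u * (s * a - b) = 0 for some u outside K. *)
Definition symbolic_power (K : ideal S) (e : nat) : set S :=
  [set a | exists b s u, [/\ ideal_pow K e b, ~ K s, ~ K u & u * (s * a - b) = 0]].

(* f_i is a nonzerodivisor modulo the preceding ones, and the f_i generate a
   proper ideal. *)
Definition regular_sequence (r : nat) (f : 'I_r -> S) : Prop :=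
  (forall (i : 'I_r) (x : S),
     let I := ideal_gen [set f j | j in [set j : 'I_r | (j < i)%N]] in
     I (x * f i) -> I x) /\
  ~ ideal_gen (range f) 1.

End IdealGen.

Section SubringGen.
Variables (S : comPzRingType) (X : set S).

Definition subring_gen : {pred S} :=
  fun x => `[< forall P : {pred S},
                 subring_closed P -> (forall y, X y -> y \in P) -> x \in P >].

Fact subring_gen_closed : subring_closed subring_gen.
Proof.
split.
- by apply/asboolP => P [].
- move=> x y /asboolP Xx /asboolP Xy; apply/asboolP => P cP XP.
  by case: (cP) => _ + _; apply; [apply: Xx | apply: Xy].
- move=> x y /asboolP Xx /asboolP Xy; apply/asboolP => P cP XP.
  by case: (cP) => _ _; apply; [apply: Xx | apply: Xy].
Qed.

Lemma mem_subring_gen x : X x -> x \in subring_gen.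
Proof. by move=> Xx; apply/asboolP => P _; apply. Qed.

HB.instance Definition _ :=
  GRing.isSubringClosed.Build S subring_gen subring_gen_closed.

Record subring := Subring { subring_val :> S; _ : subring_val \in subring_gen }.

HB.instance Definition _ := [isSub for subring_val].
HB.instance Definition _ := [Choice of subring by <:].
HB.instance Definition _ := GRing.SubChoice_isSubComPzRing.Build S subring_gen subring
  subring_gen_closed.

End SubringGen.

(* A_deg e is the set of homogeneous elements of degree e. *)
Definition homogeneous_sub (A : comPzRingType) (A_deg : nat -> set A)
    (N : set A) : Prop :=
  forall x, N x -> exists (b : nat) (y : nat -> A),
    (forall e, A_deg e (y e) /\ N (y e)) /\ x = \sum_(e < b) y e.

(* For ideals N and N', N(-s) and N' are isomorphic as graded A-modules: an
   A-linear bijection from N to N' raises degrees by s, as N(-s) lives in degree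
   e + s where N lives in degree e. Only the values of psi on N matter. *)
Definition graded_shift_iso (A : comPzRingType) (A_deg : nat -> set A)
    (s : nat) (N N' : set A) : Prop :=
  [/\ homogeneous_sub A_deg N, homogeneous_sub A_deg N' &
    exists psi : A -> A,
      [/\ set_bij N N' psi,
          (forall a x y, N x -> N y -> psi (a * x + y) = a * psi x + psi y) &
          (forall e x, N x -> A_deg e x -> A_deg (e + s)%N (psi x)) ] ].

Section MultiIndex.
Variable n : nat.

(* (j_(n-1), ..., j_1) is stored as the nondecreasing function i |-> j_(i+1). *)
Definition multiindex (a : nat) : Type :=
  {j : {ffun 'I_n.-1 -> 'I_a.+1} |
    [forall p : 'I_n.-1, forall q : 'I_n.-1, (p <= q)%N ==> (j p <= j q)%N]}.

Variable a : nat.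
Implicit Type j : multiindex a.

(* j_i for 0 <= i <= n, with j_0 = 0 and j_n = a. *)
Definition jval j (i : nat) : nat :=
  if i is i'.+1 then
    if insub i' is Some p then val (val j p) else a
  else 0%N.

Definition multiindex_pos j : bool := (0 < jval j 1)%N.

Definition jmon j : 'X_{1..n} :=
  [multinom (jval j i.+1 - jval j i)%N | i < n]%MM.

Definition jshift_ffun j (s : nat) : {ffun 'I_n.-1 -> 'I_a.+1} :=
  [ffun p : 'I_n.-1 => Ordinal (leq_ltn_trans (leq_subr (p < s)%N _) (ltn_ord (val j p)))].

Fact jshift_proof j s :
  [forall p : 'I_n.-1, forall q : 'I_n.-1,
    (p <= q)%N ==> (jshift_ffun j s p <= jshift_ffun j s q)%N].
Proof.
apply/forallP => p; apply/forallP => q; apply/implyP => pq; rewrite !ffunE /=.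
have jpq : (val j p <= val j q)%N.
  by have /forallP/(_ p)/forallP/(_ q)/implyP := valP j; apply.
by apply: leq_sub => //; case: (ltnP q s) => // qs; rewrite (leq_ltn_trans pq qs).
Qed.

(* (j_(n-1), ..., j_(s+1), j_s - 1, ..., j_1 - 1); the differences are truncated
   only when j_1 = 0. *)
Definition jshift j (s : nat) : multiindex a := Sub (jshift_ffun j s) (jshift_proof j s).

Lemma jval_le j i : (jval j i <= a)%N.
Proof. by case: i => [//|i] /=; case: insubP => // p _ _; rewrite -ltnS. Qed.

Lemma jval_mono j i : (jval j i <= jval j i.+1)%N.
Proof.
case: i => [//|i] /=; case: (ltnP i.+1 n.-1) => iltn.
  rewrite (insubT (fun p => p < n.-1)%N iltn) (insubT (fun p => p < n.-1)%N (ltnW iltn)) /=.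
  by have /forallP/(_ (Sub i (ltnW iltn)))/forallP/(_ (Sub i.+1 iltn))/implyP := valP j; apply.
rewrite (insubF _ (x := i.+1)) ?ltnNge ?iltn //.
by case: insubP => // p _ _; rewrite -ltnS.
Qed.

Lemma jval_n j i : (0 < i)%N -> (n <= i)%N -> jval j i = a.
Proof.
case: i => // i _ ni; rewrite /jval insubF //; apply/negbTE.
by rewrite -leqNgt -subn1 leq_subLR add1n.
Qed.

Lemma mdeg_jmon j : (0 < n)%N -> mdeg (jmon j) = a.
Proof.
move=> n0; rewrite mdegE -[RHS](jval_n j n0 (leqnn n)) -[RHS]subn0 -[X in (_ - X)%N]/(jval j 0).
rewrite -(@telescope_sumn_in 0 n (jval j)) //; last by move=> i _; exact: jval_mono.
by rewrite big_mkord; apply: eq_bigr => i _; rewrite mnmE.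
Qed.

End MultiIndex.

Section Rees.
Variables (S : comNzRingType) (I : ideal S).

(* S[It] is the subring of S[t] generated by S and It. *)
Definition rees_gens : set {poly S} :=
  range (@polyC S) `|` [set c *: 'X | c in (I : set S)].

Definition rees : comPzRingType := subring rees_gens.

Definition rees_const (c : S) : rees :=
  Subring (mem_subring_gen (or_introl (imageT (@polyC S) c) : rees_gens c%:P)).

Definition rees_t (c : S) (Ic : I c) : rees :=
  Subring (mem_subring_gen
    (or_intror (ex_intro2 _ _ c Ic erefl) : rees_gens (c *: 'X))).

Definition special_fiber (m : ideal S) : comPzRingType :=
  qring (ideal_gen [set rees_const c | c in (m : set S)]).

End Rees.

Definition det_ideal (S : comNzRingType) (p q t : nat) (B : 'M[S]_(p, q)) : ideal S :=
  ideal_gen [set x | exists (g : 'I_t -> 'I_p) (h : 'I_t -> 'I_q),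
    [/\ {homo g : u v / (u < v)%N}, {homo h : u v / (u < v)%N} &
        x = \det (mxsub g h B)]].

Section Truncation.
Variables (k : fieldType) (n : nat).
Local Notation R := {mpoly k[n]}.

Definition irrelevant : ideal R := ideal_gen (range (fun i : 'I_n => 'X_i : R)).

Lemma irrelevant_pow_mon (m : 'X_{1..n}) : ideal_pow irrelevant (mdeg m) 'X_[m].
Proof.
move em: (mdeg m) => e; elim: e m em => [|e IHe] m.
  by move/eqP; rewrite mdeg_eq0 => /eqP -> /=; rewrite mpolyX0; apply: sub_ideal_gen.
move=> me; have [i mi] : exists i, (0 < m i)%N.
  apply/existsP; apply: contra_eqT me; rewrite negb_exists => /forallP m0.
  rewrite mdegE big1 // => i _; apply/eqP; rewrite -leqn0 leqNgt; exact: m0.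
have Um : (U_(i) <= m)%MM by rewrite lep1mP -lt0n.
rewrite -(submK Um) addmC mpolyXD /=; apply: sub_ideal_gen.
exists 'X_i, 'X_[m - U_(i)]; split=> //.
  by apply: sub_ideal_gen; exists i.
by apply: IHe; apply/eqP; rewrite -(eqn_add2r 1) -(mdeg1 i) -mdegD submK // me mdeg1 addn1.
Qed.

Variables (r : nat) (f : 'I_r -> R) (a : 'I_r -> nat).

(* m^(a_1) f_1 + ... + m^(a_r) f_r; see [truncationE]. *)
Definition truncation : ideal R :=
  ideal_gen [set x | exists l g, ideal_pow irrelevant (a l) g /\ x = g * f l].

Lemma truncation_gen l (j : multiindex n (a l)) :
  (0 < n)%N -> truncation ('X_[jmon j] * f l).
Proof.
move=> n0; apply: sub_ideal_gen; exists l, 'X_[jmon j]; split=> //.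
by have := irrelevant_pow_mon (jmon j); rewrite (mdeg_jmon j n0).
Qed.

Lemma ideal_pow_le (e e' : nat) x :
  (e <= e')%N -> ideal_pow irrelevant e' x -> ideal_pow irrelevant e x.
Proof.
move=> /subnK <-; elim: (e' - e)%N x => [//|b IHb] x; rewrite addSn /=; apply.
by move=> _ [y [z [_ Iz ->]]]; apply: idealM; exact: IHb.
Qed.

Lemma mcoeffM_eq0 (p q : R) (m : 'X_{1..n}) :
  (forall u v, m = (u + v)%MM -> p@_u * q@_v = 0) -> (p * q)@_m = 0.
Proof. by move=> pq0; rewrite mcoeffM big1 // => -[u v] /= /eqP/pq0. Qed.

Definition order_ge (b : nat) (x : R) : Prop :=
  forall m : 'X_{1..n}, (mdeg m < b)%N -> x@_m = 0.

Fact order_ge0 b : order_ge b 0.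
Proof. by move=> m _; rewrite mcoeff0. Qed.

Fact order_geMD b c x y : order_ge b x -> order_ge b y -> order_ge b (c * x + y).
Proof.
move=> x0 y0 m mb; rewrite mcoeffD y0 // addr0 mcoeffM_eq0 // => u v E.
by rewrite x0 ?mulr0 //; move: mb; rewrite E mdegD; apply/leq_ltn_trans/leq_addl.
Qed.

Lemma irrelevant_pow_order e g : ideal_pow irrelevant e g -> order_ge e g.
Proof.
elim: e g => [//|e IHe] g Ig.
apply: (Ig (Ideal (@order_ge0 e.+1) (@order_geMD e.+1))).
move=> _ [y [z [Iy Iz ->]]] m me /=.
have /= y1 : order_ge 1 y.
  apply: (Iy (Ideal (@order_ge0 1) (@order_geMD 1))) => _ [i _ <-] u.
  rewrite ltnS leqn0 mdeg_eq0 => /eqP ->.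
  by rewrite mcoeffX; case: eqP => // /(congr1 mdeg); rewrite mdeg1 mdeg0.
apply: mcoeffM_eq0 => u v E; case: (ltnP (mdeg u) 1) => [/y1 -> | u1]; first by rewrite mul0r.
rewrite (IHe z) ?mulr0 //; move: me; rewrite E mdegD ltnS.
by apply: leq_trans; rewrite -add1n leq_add2r.
Qed.

Lemma ideal_gen_range (x : R) :
  ideal_gen (range f) x -> exists c : 'I_r -> R, x = \sum_l c l * f l.
Proof.
pose J (y : R) := exists c : 'I_r -> R, y = \sum_l c l * f l.
have J0 : J 0 by exists (fun=> 0); rewrite big1 // => l _; rewrite mul0r.
have JMD b y z : J y -> J z -> J (b * y + z).
  move=> [c ->] [c' ->]; exists (fun l => b * c l + c' l).
  by rewrite mulr_sumr -big_split /=; apply: eq_bigr => l _; rewrite mulrDl mulrA.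
move=> /(_ (Ideal J0 JMD)); apply => _ [l _ <-] /=.
exists (fun l' => (l' == l)%:R); rewrite (bigD1 l) //= eqxx mul1r big1 ?addr0 //.
by move=> l' /negbTE ->; rewrite mul0r.
Qed.

(* The truncation is (f_1, ..., f_r)_{>= d}: the elements of (f_1, ..., f_r)
   all of whose homogeneous components have degree at least d. *)
Lemma truncationE (dd : 'I_r -> nat) (d : nat) (x : R) :
  (forall l, f l \is (dd l).-homog) -> (forall l, (dd l <= d)%N) ->
  (forall l, a l = (d - dd l)%N) ->
  truncation x <-> ideal_gen (range f) x /\ order_ge d x.
Proof.
move=> fh led aE.
have fdeg l u : mdeg u != dd l -> (f l)@_u = 0 by move=> ul; apply: dhomog_nemf_coeff (fh l) _.
have Tord y : truncation y -> order_ge d y.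
  move=> Ty; apply: (Ty (Ideal (@order_ge0 d) (@order_geMD d))).
  move=> _ [l [g [/irrelevant_pow_order Ig ->]]] m md /=; apply: mcoeffM_eq0 => u v E.
  have [vl|/fdeg ->] := eqVneq (mdeg v) (dd l); last by rewrite mulr0.
  rewrite Ig ?mul0r // aE ltn_subRL addnC; by move: md; rewrite E mdegD vl.
split=> [Tx|[/ideal_gen_range [c xE] xd]].
  split; last exact: Tord.
  by apply: Tx => _ [l [g [_ ->]]]; apply: idealM; apply: sub_ideal_gen; exists l.
pose hi l := \sum_(m <- msupp (c l) | (a l <= mdeg m)%N) (c l)@_m *: 'X_[m] : R.
pose lo l := \sum_(m <- msupp (c l) | ~~ (a l <= mdeg m)%N) (c l)@_m *: 'X_[m] : R.
have cE l : c l = hi l + lo l by rewrite {1}[c l]mpolyE (bigID (fun m => a l <= mdeg m)%N).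
pose z := \sum_l hi l * f l; pose y := \sum_l lo l * f l.
have {}xE : x = z + y.
  by rewrite xE -big_split /=; apply: eq_bigr => l _; rewrite -mulrDl -cE.
have Tz : truncation z.
  apply: ideal_sum => l _; apply: sub_ideal_gen; exists l, (hi l); split=> //.
  apply: ideal_sum => m lm; rewrite -mul_mpolyC; apply: idealM.
  exact: ideal_pow_le lm (irrelevant_pow_mon m).
suff y0 : y = 0 by rewrite xE y0 addr0.
apply/mpolyP => m; rewrite mcoeff0; case: (ltnP (mdeg m) d) => md.
  have : x@_m = 0 by apply: xd.
  by rewrite xE mcoeffD (Tord _ Tz) // add0r.
rewrite raddf_sum big1 //= => l _; apply: mcoeffM_eq0 => u v E.
have [vl|/fdeg ->] := eqVneq (mdeg v) (dd l); last by rewrite mulr0.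
rewrite raddf_sum big1 ?mul0r //= => w; rewrite -ltnNge => wl.
rewrite mcoeffZ mcoeffX; case: eqP => [wu|]; last by rewrite mulr0.
move: md wl; rewrite E mdegD vl wu aE ltn_subRL addnC => h1 h2.
by move: (leq_ltn_trans h1 h2); rewrite ltnn.
Qed.

End Truncation.

Section FiberRings.
Variables (k : fieldType) (n r : nat) (a : 'I_r -> nat).
Local Notation R := {mpoly k[n]}.

(* The pairs (l, j) with j in J_(a_l). *)
Definition Tindex : finType := {l : 'I_r & multiindex n (a l)}.

Local Notation T := {mpoly k[#|{: Tindex}|]}.

Definition Tvar (l : 'I_r) (j : multiindex n (a l)) : T :=
  'X_(enum_rank (existT _ l j : Tindex)).

Definition Bcol : finType := {v : Tindex | multiindex_pos (tagged v)}.

(* Rows are numbered from 0, so that row s holds the T_{l,j,s+1}. The order in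
   which [enum_val] lists the columns does not matter for I_2(B). *)
Definition Bmx : 'M[T]_(n, #|{: Bcol}|) :=
  \matrix_(s, c)
    let v : Tindex := val (enum_val c : Bcol) in @Tvar (tag v) (jshift (tagged v) s).

Definition Aring : comPzRingType := qring (det_ideal 2 Bmx).

Definition A_deg (e : nat) : set Aring :=
  [set cls (det_ideal 2 Bmx) p | p in [set p : T | p \is e.-homog]].

(* The first row of B consists of the T_{l,j} with j in J'_(a_l). *)
Definition Kideal : ideal Aring :=
  ideal_gen [set x | exists l (j : multiindex n (a l)),
    multiindex_pos j /\ x = cls (det_ideal 2 Bmx) (Tvar j)].

Local Notation Rt := {mpoly R[r]}.

Definition fiberM_gens : set Rt :=
  range (fun c : k => c%:MP%:MP) `|`
  [set x | exists l (j : multiindex n (a l)), x = 'X_[jmon j] *: 'X_l].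

Definition fiberM : comPzRingType := subring fiberM_gens.

Definition fiberM_const (c : k) : fiberM :=
  Subring (mem_subring_gen (or_introl (imageT _ c) : fiberM_gens c%:MP%:MP)).

Definition fiberM_var (l : 'I_r) (j : multiindex n (a l)) : fiberM :=
  Subring (mem_subring_gen (or_intror (ex_intro _ l (ex_intro _ j erefl)) :
    fiberM_gens ('X_[jmon j] *: 'X_l))).

(* The k-algebra map T -> F(M) sending T_{l,j} to x^{a_l,j} t_l. *)
Definition T_eval (p : T) : Rt :=
  mmap (@mpolyC r R \o @mpolyC n k)
    (fun v => let u : Tindex := enum_val v in 'X_[jmon (tagged u)] *: 'X_(tag u)) p.

Fact T_eval_subproof p : T_eval p \in subring_gen fiberM_gens.
Proof.
apply: rpred_sum => m _; apply: rpredM; first exact: (valP (fiberM_const _)).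
by apply: rpred_prod => v _; apply: rpredX; exact: (valP (fiberM_var _)).
Qed.

Definition T_to_fiberM (p : T) : fiberM := Subring (T_eval_subproof p).

Variable f : 'I_r -> R.

Definition hform (i j : 'I_r) (m : 'X_{1..n}) : T :=
  - (\sum_(u : multiindex n (a i)) ('X_[m] * f j)@_(jmon u) *: Tvar u)
  + \sum_(u : multiindex n (a j)) ('X_[m] * f i)@_(jmon u) *: Tvar u.

(* {h_1, ..., h_t}, where dd i = d_i; the equation on d says that
   mdeg m = d - d_i - d_j >= 0. *)
Definition hforms (dd : 'I_r -> nat) (d : nat) : set T :=
  [set p | exists (i j : 'I_r) (m : 'X_{1..n}),
    [/\ (i < j)%N, (dd i + dd j + mdeg m)%N = d & p = hform i j m]].

Definition fiberI : comPzRingType :=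
  special_fiber (truncation f a) (irrelevant k n).

Definition fiberI_const (c : k) : fiberI := cls _ (rees_const (truncation f a) c%:MP).

(* The class of x^{a_l,j} f_l t. *)
Definition fiberI_var (n_gt0 : (0 < n)%N) (l : 'I_r) (j : multiindex n (a l)) : fiberI :=
  cls _ (rees_t (@truncation_gen k n r f a l j n_gt0)).

(* P and Q are k-algebras, with structure maps cP and cQ, isomorphic by a map
   sending vP l j to vQ l j. *)
Definition alg_iso_on_vars (P Q : comPzRingType)
    (cP : k -> P) (vP : forall l, multiindex n (a l) -> P)
    (cQ : k -> Q) (vQ : forall l, multiindex n (a l) -> Q) : Prop :=
  exists phi : {rmorphism P -> Q},
    [/\ bijective phi, forall c, phi (cP c) = cQ c &
        forall l (j : multiindex n (a l)), phi (vP l j) = vQ l j].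

End FiberRings.

(* Main.v *)
Require Import Defs.
From HB Require Import structures.
From mathcomp Require Import all_boot all_order all_algebra.
From mathcomp Require Import boolp classical_sets functions.
From mathcomp Require Import mpoly zify.

Set Implicit Arguments.
Unset Strict Implicit.
Unset Printing Implicit Defensive.

Import GRing.Theory.
Local Open Scope ring_scope.
Local Open Scope classical_set_scope.

(* Give k[x][t_1, ..., t_r] the grading in which x_i has degree 1 and t_l has degree
   - a_l. The map T_{l,j} |-> x^j t_l has the degree 0 part as its image, and I_2(B)
   as its kernel: a monomial of T with the factor T_{l,m} is changed, by exchanging
   x_s and x_s' between two of its factors, into one with any prescribed factor
   T_{l,m'} for which x^m' divides its image. The special fiber ring of I is the
   quotient of T by the polynomials that vanish at T_{l,j} = x^j f_l t, because I is
   generated in the single degree d. For a regular sequence the kernel of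
   t_l |-> f_l t is generated by the f_i t_j - f_j t_i, of degree d_i + d_j - d.

   If d >= d_1 + d_2, the degree 0 part of this kernel is generated by the multiples
   m (f_i t_j - f_j t_i) of degree 0, which are the images of the h's. If r = 2 and
   delta = d_1 + d_2 - d > 0, it is F P with F = f_1 t_2 - f_2 t_1 and P the part
   of degree - delta, while K^(delta) is x_1^delta P; so x_1^delta G |-> F G is the
   isomorphism. *)

(** What separates the two cases is the sign of d - d_i - d_j, the degree that a cofactor of f_i t_j
    - f_j t_i must have for the product to have degree 0. If it is nonnegative, every term of the
    cofactor splits into a monomial m of R of exactly this degree and a term of degree 0, and the
    latter already lies in F(M); this is why only these m occur in the h's. If it is negative, the
    cofactors lie outside F(M). To compare the kernel with an ideal of F(M), they are multiplied by
    x_1^delta, which brings them to degree 0. The variable x_1 is singled out by the first row of B: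
    K consists of the elements of F(M) that are divisible by x_1 in R[t_1, ..., t_r]. Since x_1 is
    prime there, passing to the symbolic power allows elements outside K to be cancelled and leaves
    exactly divisibility by x_1^delta. The shift by one in the grading is the degree of F in the
    t_l. *)

Section RingMaps.

(** The map lifts along a chosen section of [al] and applies [be]; equality of the kernels makes the
    result independent of the section. Every presentation of the special fiber ring is obtained in
    this way, by comparing two surjections from T. *)
Lemma surj_same_kernel_iso (T P Q : comPzRingType)
    (al : {rmorphism T -> P}) (be : {rmorphism T -> Q}) :
    (forall y, exists x, al x = y) -> (forall y, exists x, be x = y) ->
    (forall x, al x = 0 <-> be x = 0) ->
  exists phi : {rmorphism P -> Q}, bijective phi /\ forall x, phi (al x) = be x.
Proof.
move=> /choice [s sK] /choice [s' s'K] ker.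
have eqker x y : al x = al y <-> be x = be y.
  split=> /eqP; rewrite -subr_eq0 -rmorphB => /eqP.
    by move=> /ker; rewrite rmorphB => /eqP; rewrite subr_eq0 => /eqP.
  by move=> /(ker _); rewrite rmorphB => /eqP; rewrite subr_eq0 => /eqP.
pose phi y := be (s y).
have phiE x : phi (al x) = be x by apply/eqker; rewrite sK.
have phi_zmod : zmod_morphism phi.
  by move=> x y; rewrite -[x]sK -[y]sK -rmorphB !phiE rmorphB.
have phi_mon : monoid_morphism phi.
  split=> [|x y]; first by rewrite -(rmorph1 al) phiE rmorph1.
  by rewrite -[x]sK -[y]sK -rmorphM !phiE rmorphM.
pose mz := GRing.isZmodMorphism.Build P Q phi phi_zmod.
pose mm := GRing.isMonoidMorphism.Build P Q phi phi_mon.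
pose phiR : {rmorphism P -> Q} := HB.pack phi mz mm.
exists phiR; split=> [|x]; last exact: phiE.
exists (al \o s') => x /=; last by rewrite /= phiE s'K.
by rewrite -[RHS]sK; apply/eqker; rewrite s'K.
Qed.

Section SubringLift.
Variables (T S : comPzRingType) (X : set S) (g : {rmorphism T -> S}).
Hypothesis gX : forall x, g x \in subring_gen X.

Definition subring_lift (x : T) : subring X := Subring (gX x).

Fact subring_lift_zmod : zmod_morphism subring_lift.
Proof. by move=> x y; apply: val_inj; rewrite /= rmorphB. Qed.
Fact subring_lift_monoid : monoid_morphism subring_lift.
Proof.
split=> [|x y]; apply: val_inj; first by rewrite /= rmorph1.
by rewrite /= rmorphM.
Qed.
HB.instance Definition _ :=
  GRing.isZmodMorphism.Build T (subring X) subring_lift subring_lift_zmod.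
HB.instance Definition _ :=
  GRing.isMonoidMorphism.Build T (subring X) subring_lift subring_lift_monoid.
End SubringLift.

Lemma cls_eq0 (S : comPzRingType) (I : ideal S) x : cls I x = 0 <-> I x.
Proof. by rewrite -(rmorph0 (cls I)) clsE subr0. Qed.

Lemma idealN (S : comPzRingType) (I : ideal S) x : I x -> I (- x).
Proof. by move=> Ix; rewrite -mulN1r; apply: idealM. Qed.

Lemma idealB (S : comPzRingType) (I : ideal S) x y : I x -> I y -> I (x - y).
Proof. by move=> Ix Iy; apply: idealD => //; apply: idealN. Qed.

(** Membership in [ideal_gen X] quantifies over the ideals containing [X], so it is exploited by
    applying it to a suitable ideal. Kernels and preimages serve for this; [Defined] keeps
    membership convertible to the underlying property. *)
Definition ker_ideal (S Q : comPzRingType) (g : {rmorphism S -> Q}) : ideal S.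
Proof.
apply: (@Ideal S (fun x => g x = 0)); first exact: rmorph0.
by move=> a x y gx gy; rewrite rmorphD rmorphM gx gy mulr0 addr0.
Defined.

Definition preim_ideal (S Q : comPzRingType) (g : {rmorphism S -> Q}) (I : ideal Q) :
  ideal S.
Proof.
apply: (@Ideal S (fun x => I (g x))); first by rewrite rmorph0; exact: ideal_set0.
by move=> a x y Ix Iy; rewrite rmorphD rmorphM; apply: ideal_setMD.
Defined.

End RingMaps.

(** * Relations of a regular sequence *)

Section Koszul.

(** The assumption [p@_m != 0] hands to each term whatever is known about the support of [p]. *)
Lemma mpoly_term_ind (n : nat) (S : nzRingType) (Q : {mpoly S[n]} -> Prop) p :
  Q 0 -> (forall x y, Q x -> Q y -> Q (x + y)) ->
  (forall m, p@_m != 0 -> Q (p@_m *: 'X_[m])) -> Q p.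
Proof.
move=> Q0 QD QX; rewrite [p]mpolyE big_seq; elim/big_ind: _ => // m.
by rewrite mcoeff_msupp; exact: QX.
Qed.

Lemma mnm_gt0_ex (n : nat) (m : 'X_{1..n}) : (0 < mdeg m)%N -> exists i, (0 < m i)%N.
Proof.
move=> m0; apply/existsP; apply: contraTT m0; rewrite negb_exists => /forallP m0.
by rewrite -eqn0Ngt mdegE big1 // => i _; apply/eqP; rewrite -leqn0 leqNgt; exact: m0.
Qed.

Lemma mnm_subU (n : nat) (m : 'X_{1..n}) i : (0 < m i)%N -> (U_(i) + (m - U_(i)))%MM = m.
Proof. by move=> mi; rewrite addmC submK // lep1mP -lt0n. Qed.

Variables (S : comNzRingType) (r : nat) (f : 'I_r -> S).
Local Notation P := {mpoly S[r]}.

Definition koszul (q : nat) : ideal P :=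
  ideal_gen [set x | exists i j : 'I_r, [/\ (i < j)%N, (j < q)%N &
    x = f i *: 'X_j - f j *: 'X_i]].

Definition initial_ideal (q : nat) : ideal S :=
  ideal_gen [set f j | j in [set j : 'I_r | (j < q)%N]].

(** The ring keeps all [r] variables and [q] only limits which of them occur, so that an induction
    on [q] stays inside one ring. *)
Definition forms (q e : nat) (p : P) : Prop :=
  forall m, p@_m != 0 -> mdeg m = e /\ forall i : 'I_r, (q <= i)%N -> m i = 0%N.

Lemma forms0 q e : forms q e 0.
Proof. by move=> m; rewrite mcoeff0 eqxx. Qed.

Lemma formsD q e p p' : forms q e p -> forms q e p' -> forms q e (p + p').
Proof.
move=> Hp Hp' m; rewrite mcoeffD; have [->|/Hp //] := eqVneq p@_m 0.
by rewrite add0r; exact: Hp'.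
Qed.

Lemma formsZ q e c p : forms q e p -> forms q e (c *: p).
Proof.
by move=> Hp m; rewrite mcoeffZ => h; apply: Hp; apply: contraNneq h => ->; rewrite mulr0.
Qed.

Lemma formsX q e m :
  mdeg m = e -> (forall i : 'I_r, (q <= i)%N -> m i = 0%N) -> forms q e 'X_[m].
Proof. by move=> me mq m'; rewrite mcoeffX; case: (m =P m') => [<- //|_]; rewrite eqxx. Qed.

Lemma formsC c q : forms q 0 c%:MP.
Proof.
move=> m; rewrite mcoeffC; case: (m =P 0%MM) => [->|_]; last by rewrite mulr0 eqxx.
by rewrite mdeg0; split=> // i _; rewrite mnm0E.
Qed.

Lemma forms_sum q e (I : Type) (s : seq I) (Q : pred I) (F : I -> P) :
  (forall i, Q i -> forms q e (F i)) -> forms q e (\sum_(i <- s | Q i) F i).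
Proof. by move=> HF; elim/big_ind: _ => //; [exact: forms0 | exact: formsD]. Qed.

Lemma formsXM q e (i : 'I_r) p : (i < q)%N -> forms q e p -> forms q e.+1 ('X_i * p).
Proof.
move=> iq Hp; rewrite [p]mpolyE mulr_sumr big_seq; apply: forms_sum => m.
rewrite mcoeff_msupp => /Hp [me mq]; rewrite -scalerAr -mpolyXD; apply: formsZ.
apply: formsX => [|j qj]; first by rewrite mdegD mdeg1 me.
by rewrite mnmDE mq // mnm1E; case: eqP => // ij; move: iq; rewrite ij ltnNge qj.
Qed.

Lemma forms_le q q' e p : (q <= q')%N -> forms q e p -> forms q' e p.
Proof.
by move=> qq Hp m /Hp [me mq]; split=> // i qi; apply: mq; exact: leq_trans qi.
Qed.

Lemma forms_deg0 q p : forms q 0 p -> p = (p@_0)%:MP.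
Proof.
move=> Hp; apply/mpolyP => m; rewrite mcoeffC; have [->|m0] := eqVneq m 0%MM.
  by rewrite mulr1.
rewrite mulr0; apply/eqP; apply: contraNT m0 => /Hp [/eqP].
by rewrite mdeg_eq0.
Qed.

Lemma forms_var0 e p : forms 0 e p -> p = (p@_0)%:MP.
Proof.
move=> Hp; apply/mpolyP => m; rewrite mcoeffC; have [->|m0] := eqVneq m 0%MM.
  by rewrite mulr1.
rewrite mulr0; apply/eqP; apply: contraNT m0 => /Hp [_ mq].
by apply/eqP/mnmP => i; rewrite mnm0E mq.
Qed.

(** Each monomial is assigned to one of the variables that occur in it; the decomposition is a
    choice. *)
Lemma forms_split q e p : forms q e.+1 p -> exists Y : 'I_r -> P,
  (forall i, forms q e (Y i)) /\ p = \sum_(i < r | (i < q)%N) 'X_i * Y i.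
Proof.
move=> Hp.
apply: (@mpoly_term_ind r S (fun p => exists Y : 'I_r -> P,
  (forall i, forms q e (Y i)) /\ p = \sum_(i < r | (i < q)%N) 'X_i * Y i)).
- exists (fun=> 0); split=> [i|]; first exact: forms0.
  by rewrite big1 // => i _; rewrite mulr0.
- move=> _ _ [Y [HY ->]] [Y' [HY' ->]]; exists (fun i => Y i + Y' i); split=> [i|].
    exact: formsD.
  by rewrite -big_split; apply: eq_bigr => i _; rewrite mulrDr.
- move=> m /Hp [me mq]; have [i mi] : exists i, (0 < m i)%N by apply: mnm_gt0_ex; rewrite me.
  have iq : (i < q)%N by rewrite ltnNge; apply: contraTN mi => /mq ->.
  exists (fun i' => if i' == i then p@_m *: 'X_[m - U_(i)] else 0); split=> [i'|].
    case: eqP => _; last exact: forms0.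
    apply: formsZ; apply: formsX => [|j qj]; last by rewrite mnmBE mq.
    by apply: succn_inj; rewrite -me -{2}(mnm_subU mi) mdegD mdeg1.
  rewrite (bigD1 i) //= eqxx big1 ?addr0 => [|j /andP[_ /negbTE ->]]; last by rewrite mulr0.
  by rewrite -scalerAr -mpolyXD mnm_subU.
Qed.

Lemma forms_top (q : 'I_r) e p : forms q.+1 e.+1 p -> exists p' p'' : P,
  [/\ forms q e.+1 p', forms q.+1 e p'' & p = p' + 'X_q * p''].
Proof.
move=> Hp.
apply: (@mpoly_term_ind r S (fun p => exists p' p'' : P,
  [/\ forms q e.+1 p', forms q.+1 e p'' & p = p' + 'X_q * p''])).
- by exists 0, 0; split; rewrite ?mulr0 ?addr0; try exact: forms0.
- move=> _ _ [p1 [p2 [H1 H2 ->]]] [p3 [p4 [H3 H4 ->]]]; exists (p1 + p3), (p2 + p4).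
  by split; [exact: formsD | exact: formsD | rewrite mulrDr addrACA].
- move=> m /Hp [me mq]; have [mq0|mq0] := posnP (m q).
    exists (p@_m *: 'X_[m]), 0; rewrite mulr0 addr0; split=> //; last exact: forms0.
    apply: formsZ; apply: formsX => // i; rewrite leq_eqVlt => /orP[/eqP qi|/mq //].
    by rewrite -(val_inj qi).
  exists 0, (p@_m *: 'X_[m - U_(q)]); rewrite add0r -scalerAr -mpolyXD mnm_subU //.
  split=> //; first exact: forms0.
  apply: formsZ; apply: formsX => [|j qj]; last by rewrite mnmBE mq.
  by apply: succn_inj; rewrite -me -{2}(mnm_subU mq0) mdegD mdeg1.
Qed.

Lemma koszul_le q q' p : (q <= q')%N -> koszul q p -> koszul q' p.
Proof.
move=> qq; apply=> _ [i [j [ij jq ->]]]; apply: sub_ideal_gen.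
by exists i, j; split=> //; exact: leq_trans qq.
Qed.

Lemma initial_idealP q (i : 'I_r) : (i < q)%N -> initial_ideal q (f i).
Proof. by move=> iq; apply: sub_ideal_gen; exists i. Qed.

(** The extension of J to the polynomial ring, described by coefficients. *)
Definition coef_ideal (J : ideal S) : ideal P.
Proof.
apply: (@Ideal P (fun p => forall m, J p@_m)); first by move=> m; rewrite mcoeff0; exact: ideal_set0.
move=> a x y Jx Jy m; rewrite mcoeffD; apply: idealD => //.
by rewrite mcoeffM; apply: ideal_sum => -[u v] _ /=; apply: idealM.
Defined.

Lemma koszul_coef q p m : koszul q p -> initial_ideal q p@_m.
Proof.
move=> kp; apply: (kp (coef_ideal (initial_ideal q))) => _ [i [j [ij jq ->]]] u.
rewrite mcoeffB !mcoeffZ; apply: idealB; rewrite mulrC; apply: idealM; apply: initial_idealP => //.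
exact: ltn_trans ij jq.
Qed.

Lemma koszul_pair q (i j : 'I_r) : (i < q)%N -> (j < q)%N -> koszul q (f i *: 'X_j - f j *: 'X_i).
Proof.
move=> iq jq; case: (ltngtP i j) => [ij|ji|/val_inj ->].
- by apply: sub_ideal_gen; exists i, j.
- by rewrite -opprB; apply: idealN; apply: sub_ideal_gen; exists j, i.
- by rewrite subrr; exact: ideal_set0.
Qed.

(** A factor f_i of a coefficient is traded for the variable t_i: the degree rises by one and the
    value at f stays the same. *)
Lemma forms_meval_raise q e p : forms q e p -> (forall m, initial_ideal q p@_m) ->
  exists p', forms q e.+1 p' /\ p'.@[f] = p.@[f].
Proof.
move=> Hp Jp.
apply: (@mpoly_term_ind r S (fun p => exists p', forms q e.+1 p' /\ p'.@[f] = p.@[f])).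
- by exists 0; split=> //; exact: forms0.
- move=> x y [x' [Hx Ex]] [y' [Hy Ey]]; exists (x' + y'); rewrite !mevalD Ex Ey.
  by split=> //; exact: formsD.
- move=> m /Hp [me mq].
  pose J c := exists p', forms q e.+1 p' /\ p'.@[f] = (c *: 'X_[m]).@[f].
  have J0 : J 0 by exists 0; rewrite scale0r; split=> //; exact: forms0.
  have JMD a x y : J x -> J y -> J (a * x + y).
    move=> [x' [Hx Ex]] [y' [Hy Ey]]; exists (a *: x' + y').
    split; first by apply: formsD => //; exact: formsZ.
    by rewrite mevalD mevalZ Ex Ey !mevalZ mulrDl mulrA.
  apply: (Jp m (Ideal J0 JMD)) => _ [i iq <-]; exists ('X_i * 'X_[m]).
  split; first by apply: formsXM => //; exact: formsX.
  by rewrite mevalM mevalXU mevalZ.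
Qed.

Let A q e := forall p, forms q e p -> p.@[f] = 0 -> koszul q p.

(* A nonzerodivisor z modulo J = (f_1, ..., f_q) is one modulo J^e: if
   z X(f) = Y(f) with deg X = e - 1 and Y = sum_i t_i Y_i, then
   z X - sum_i f_i Y_i is a relation, so its coefficients lie in J. *)
Lemma nzd_forms q z : (forall e, A q e) ->
  (forall x, initial_ideal q (z * x) -> initial_ideal q x) ->
  forall e x y, forms q e y -> z * x = y.@[f] -> exists p, forms q e p /\ x = p.@[f].
Proof.
move=> Aq zJ; elim=> [|e IHe] x y Hy zx.
  by exists x%:MP; rewrite mevalC; split=> //; exact: formsC.
have [Y [HY yE]] := forms_split Hy.
pose y' := \sum_(i < r | (i < q)%N) f i *: Y i.
have Hy' : forms q e y' by apply: forms_sum => i _; exact: formsZ.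
have y'E : y'.@[f] = y.@[f].
  by rewrite yE !raddf_sum; apply: eq_bigr => i _ /=; rewrite mevalZ mevalM mevalXU.
have [p [Hp xE]] : exists p, forms q e p /\ x = p.@[f].
  by apply: (IHe x y') => //; rewrite y'E.
have Hzp : forms q e (z *: p - y').
  by rewrite -scaleN1r; apply: formsD; apply: formsZ.
have /Aq kzp := Hzp.
have [|p' [Hp' p'E]] := forms_meval_raise Hp; last by exists p'; rewrite p'E.
move=> m; apply: zJ.
have -> : z * p@_m = (z *: p - y')@_m + y'@_m by rewrite mcoeffB mcoeffZ subrK.
apply: idealD; first by apply: koszul_coef; apply: kzp; rewrite mevalB mevalZ -xE zx y'E subrr.
rewrite raddf_sum; apply: ideal_sum => i iq.
suff : initial_ideal q (mcoeff m (f i *: Y i)) by [].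
by rewrite mcoeffZ mulrC; apply: idealM; exact: initial_idealP.
Qed.

(** Induction on the number of variables, then on the degree. Write p = p' + t_q p'' with t_q absent
    from p'. At f this gives f_q p'' = - p', so [nzd_forms] yields a form u of degree e + 1 in the
    earlier variables with u(f) = p''(f). Let u' be u with one factor t_i of each term replaced by
    f_i. Then p'' - u' is a relation of degree e, p' + f_q u is a relation without t_q, and what
    remains of p, namely t_q u' - f_q u, is a combination of the f_i t_q - f_q t_i. *)
Lemma forms_koszul : (forall (i : 'I_r) x, initial_ideal i (x * f i) -> initial_ideal i x) ->
  forall q, (q <= r)%N -> forall e p, forms q e p -> p.@[f] = 0 -> koszul q p.
Proof.
move=> reg; elim=> [_ e p /forms_var0 -> |q IHq qr].
  by rewrite mevalC => ->; rewrite mpolyC0; exact: ideal_set0.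
elim=> [p /forms_deg0 -> |e IHe p Hp pf].
  by rewrite mevalC => ->; rewrite mpolyC0; exact: ideal_set0.
pose Q := Ordinal qr; have Aq := IHq (ltnW qr).
have [p' [p'' [Hp' Hp'' pE]]] := @forms_top Q _ _ Hp.
have regQ x : initial_ideal q (f Q * x) -> initial_ideal q x.
  by rewrite mulrC; exact: (reg Q).
have [u [Hu uE]] : exists u, forms q e.+1 u /\ p''.@[f] = u.@[f].
  apply: (@nzd_forms q (f Q) Aq regQ e.+1 p''.@[f] (- p')).
    by rewrite -scaleN1r; exact: formsZ.
  rewrite mevalN; apply/eqP; rewrite -addr_eq0 addrC; apply/eqP.
  by rewrite -pf pE mevalD mevalM mevalXU.
have [Y [HY uYE]] := forms_split Hu.
pose u' := \sum_(i < r | (i < q)%N) f i *: Y i.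
have Hu' : forms q.+1 e u'.
  by apply: forms_sum => i _; apply: formsZ; apply: forms_le (HY i).
have k1 : koszul q.+1 (p'' - u').
  apply: IHe; first by rewrite -scaleN1r; apply: formsD => //; exact: formsZ.
  rewrite mevalB uE uYE -mevalB /u' -sumrB raddf_sum big1 // => i _ /=.
  by rewrite mevalB mevalZ mevalM mevalXU subrr.
have k2 : koszul q.+1 (p' + f Q *: u).
  apply: (koszul_le (leqnSn q)); apply: (Aq e.+1); first by apply: formsD => //; exact: formsZ.
  by rewrite mevalD mevalZ -uE -pf pE mevalD mevalM mevalXU.
have -> : p = (p' + f Q *: u) + 'X_Q * (p'' - u')
    + \sum_(i < r | (i < q)%N) Y i * (f i *: 'X_Q - f Q *: 'X_i).
  have -> : \sum_(i < r | (i < q)%N) Y i * (f i *: 'X_Q - f Q *: 'X_i) = 'X_Q * u' - f Q *: u.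
    rewrite uYE /u' mulr_sumr scaler_sumr -sumrB; apply: eq_bigr => i _.
    by rewrite mulrBr -!scalerAr [Y i * 'X_i]mulrC [Y i * _]mulrC.
  by rewrite pE mulrBr [X in _ = X + _]addrA subrKA [RHS]addrAC addrK.
apply: idealD; first by apply: idealD => //; exact: idealM.
by apply: ideal_sum => i iq; apply: idealM; apply: koszul_pair => //; exact: ltnW.
Qed.

End Koszul.

(** * The kernel of T -> F(M) *)

Lemma det_mx22 (S : comNzRingType) (M : 'M[S]_2) :
  \det M = M 0 0 * M 1 1 - M 0 1 * M 1 0.
Proof.
rewrite (expand_det_row _ 0) !big_ord_recl big_ord0 /cofactor !det_mx11 !mxE addr0.
rewrite expr0 mul1r expr1 mulN1r mulrN.
by do !(congr (_ + _) || congr (- _) || congr (_ * _) || congr (M _ _)); apply: val_inj.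
Qed.

Section Minors.
Variables (S : comNzRingType) (p q : nat) (B : 'M[S]_(p, q)).

Lemma det_ideal2_lt (s s' : 'I_p) (c c' : 'I_q) : (s < s')%N -> (c < c')%N ->
  det_ideal 2 B (B s c * B s' c' - B s c' * B s' c).
Proof.
move=> ss cc; apply: sub_ideal_gen.
exists (fun u => if u == ord0 then s else s'), (fun u => if u == ord0 then c else c').
split; last by rewrite det_mx22 !mxE.
- by case=> [[|[|//]] ?] [[|[|//]] ?].
- by case=> [[|[|//]] ?] [[|[|//]] ?].
Qed.

(** [det_ideal] takes increasing rows and columns; any other choice changes the sign of a minor or
    makes it zero. *)
Lemma det_ideal2 (s s' : 'I_p) (c c' : 'I_q) :
  det_ideal 2 B (B s c * B s' c' - B s' c * B s c').
Proof.
have [ss|ss|/val_inj ->] := ltngtP s s'; have [cc|cc|/val_inj ->] := ltngtP c c';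
  rewrite ?subrr; try exact: ideal_set0.
- by rewrite [B s' c * _]mulrC; exact: det_ideal2_lt.
- by rewrite -opprB; apply: idealN; rewrite [B s' c * _]mulrC; exact: det_ideal2_lt.
- by rewrite mulrC subrr; exact: ideal_set0.
- by rewrite -opprB; apply: idealN; rewrite [B s c * _]mulrC; exact: det_ideal2_lt.
- by rewrite [B s c * _]mulrC; exact: det_ideal2_lt.
- by rewrite mulrC subrr; exact: ideal_set0.
Qed.

Lemma det_ideal2_min (J : ideal S) :
  (forall s s' c c', J (B s c * B s' c' - B s c' * B s' c)) ->
  forall x, det_ideal 2 B x -> J x.
Proof.
by move=> JB x; apply=> _ [g [h [_ _ ->]]]; rewrite det_mx22 !mxE.
Qed.

End Minors.

Section MultiIndexTheory.
Variables (n a : nat).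
Implicit Type j : multiindex n a.

(** Partial sums of exponents recover the multi-index. Hence multi-indices correspond bijectively to
    monomials of degree [a], and the later arguments speak of monomials only. *)
Lemma jval_sum j i : (i <= n)%N -> jval j i = (\sum_(t < n | (t < i)%N) jmon j t)%N.
Proof.
elim: i => [|i IHi] iN; first by rewrite big1.
rewrite (bigD1 (Ordinal iN)) //= [X in (_ + X)%N](_ : _ = jval j i); last first.
  rewrite IHi ?(ltnW iN) //; apply: eq_bigl => t.
  by rewrite -val_eqE /= ltnS andbC -ltn_neqAle.
by rewrite mnmE /= subnK //; exact: jval_mono.
Qed.

Lemma jmon_inj : injective (@jmon n a).
Proof.
move=> j j' jj; apply/val_inj/ffunP => p; apply/val_inj.
have pn : (p.+1 <= n)%N by have := ltn_ord p; lia.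
have : jval j p.+1 = jval j' p.+1 by rewrite !jval_sum // jj.
by rewrite /jval insubT //= => pn'; have -> : Sub (val p) pn' = p by exact: val_inj.
Qed.

Lemma jmon_surj (m : 'X_{1..n}) : (0 < n)%N -> mdeg m = a -> exists j, jmon j = m.
Proof.
move=> n0 ma; pose F i := (\sum_(t < n | (t < i)%N) m t)%N.
have Fle i : (F i < a.+1)%N.
  by rewrite ltnS -ma mdegE [leqRHS](bigID (fun t : 'I_n => (t < i)%N)) leq_addr.
have Fmono i i' : (i <= i')%N -> (F i <= F i')%N.
  move=> ii; rewrite /F [leqRHS](bigID (fun t : 'I_n => (t < i)%N)) /=.
  rewrite [X in (_ <= X + _)%N](eq_bigl (fun t : 'I_n => (t < i)%N)) ?leq_addr // => t.
  by rewrite andb_idl // => ti; exact: leq_trans ii.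
pose j0 := [ffun p : 'I_n.-1 => Ordinal (Fle p.+1)].
have j0P : [forall p : 'I_n.-1, forall q : 'I_n.-1, (p <= q)%N ==> (j0 p <= j0 q)%N].
  apply/forallP => p; apply/forallP => q; apply/implyP => pq.
  by rewrite !ffunE /=; exact: Fmono.
pose j : multiindex n a := Sub j0 j0P.
have jE i : (i <= n)%N -> jval j i = F i.
  case: i => [_|i iN]; first by rewrite /F big1.
  rewrite /jval; case: insubP => [p _ <-|]; first by rewrite /= ffunE.
  rewrite -leqNgt => ni; have -> : i.+1 = n by apply/eqP; rewrite eqn_leq iN; lia.
  by rewrite /F -ma mdegE; apply: eq_bigl => t; rewrite ltn_ord.
exists j; apply/mnmP => i; rewrite mnmE !jE ?(ltnW (ltn_ord i)) //.
rewrite /F (bigD1 i) //= [X in (_ + X - _)%N](_ : _ = F i); first by rewrite addnK.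
by apply: eq_bigl => t; rewrite -val_eqE /= ltnS andbC -ltn_neqAle.
Qed.

Lemma jval_shift j s i : (s < n)%N -> jval (jshift j s) i = (jval j i - (i <= s)%N)%N.
Proof.
move=> sn; case: i => [//|i] /=; case: insubP => [p _ <-|]; first by rewrite ffunE.
by rewrite -leqNgt => ni; rewrite (_ : (i < s)%N = false) ?subn0 //; lia.
Qed.

Lemma multiindex_posE j (i0 : 'I_n) : i0 = 0%N :> nat -> multiindex_pos j = (0 < jmon j i0)%N.
Proof. by move=> i00; rewrite mnmE i00 subn0. Qed.

(** The entry of B in row s stands for x_s x^j / x_1. Multiplying by x_1 on the left avoids a
    truncated subtraction of exponents. *)
Lemma jmon_shift j (i0 s : 'I_n) : i0 = 0%N :> nat -> multiindex_pos j ->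
  (U_(i0) + jmon (jshift j s) = U_(s) + jmon j)%MM.
Proof.
rewrite /multiindex_pos => i00 j1; apply/mnmP => i; rewrite !mnmDE !mnmE !jval_shift //.
have jpos t : (0 < t)%N -> (0 < jval j t)%N.
  by elim: t => [//|[//|t] IHt] _; apply: leq_trans (jval_mono j _); exact: IHt.
have := jval_mono j i; have := jpos i.+1 isT; have := jpos i; rewrite -!val_eqE /= i00.
case: (ltngtP i s); case: (posnP i) => [-> /=|]; lia.
Qed.

End MultiIndexTheory.

(** * Polynomials in x and t with prescribed bidegrees *)

Section BigradedSupport.
Variables (k : fieldType) (n r : nat).
Local Notation R := {mpoly k[n]}.
Local Notation Rt := {mpoly R[r]}.
Implicit Types (P : Rt) (b : 'X_{1..r}) (m : 'X_{1..n}).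

(** Homogeneity for the various gradings and divisibility by x_1 are both conditions on the
    exponents of the terms, so one predicate covers them. *)
Definition bisupp (Q : 'X_{1..r} -> 'X_{1..n} -> bool) P : Prop :=
  forall b m, P@_b@_m != 0 -> Q b m.

Lemma coef_biterm c b m b' m' :
  (((c *: 'X_[m]) *: 'X_[b] : Rt)@_b')@_m' = c * (m == m')%:R * (b == b')%:R.
Proof.
by rewrite mcoeffZ mcoeffX; case: eqP => _; rewrite ?mulr1 ?mulr0 ?mcoeff0 // mcoeffZ mcoeffX.
Qed.

Lemma bisupp_ind (C : Rt -> Prop) Q P : bisupp Q P -> C 0 ->
  (forall x y, C x -> C y -> C (x + y)) ->
  (forall c b m, Q b m -> C ((c *: 'X_[m]) *: 'X_[b])) -> C P.
Proof.
move=> HP C0 CD CX; apply: mpoly_term_ind => // b _.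
have := HP b; move: (P@_b) => p Hp.
apply: (@mpoly_term_ind n k (fun p => C (p *: 'X_[b]))) => [|x y|m pm].
- by rewrite scale0r.
- by rewrite scalerDl; exact: CD.
- by apply: CX; exact: Hp.
Qed.

Lemma bisupp0 Q : bisupp Q 0.
Proof. by move=> b m; rewrite !mcoeff0 eqxx. Qed.

Lemma bisuppD Q P P' : bisupp Q P -> bisupp Q P' -> bisupp Q (P + P').
Proof.
move=> HP HP' b m; rewrite !mcoeffD; have [->|/HP //] := eqVneq P@_b@_m 0.
by rewrite add0r; exact: HP'.
Qed.

Lemma bisuppN Q P : bisupp Q P -> bisupp Q (- P).
Proof. by move=> HP b m; rewrite !mcoeffN oppr_eq0; exact: HP. Qed.

Lemma bisupp_term (Q : _ -> _ -> bool) c b m : Q b m -> bisupp Q ((c *: 'X_[m]) *: 'X_[b]).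
Proof.
move=> Qbm b' m'; rewrite coef_biterm.
by case: (m =P m') => [<-|_]; case: (b =P b') => [<-|_]; rewrite ?mulr0 ?mul0r ?eqxx.
Qed.

Lemma biterm_mul c b m c' b' m' :
  ((c *: 'X_[m]) *: 'X_[b]) * ((c' *: 'X_[m']) *: 'X_[b']) =
  ((c * c') *: 'X_[m + m']) *: 'X_[b + b'] :> Rt.
Proof.
by rewrite -scalerAl -scalerAr scalerA -mpolyXD -scalerAl -scalerAr scalerA -mpolyXD.
Qed.

Lemma bitermX_mul c b m b' m' :
  ((c *: 'X_[m]) *: 'X_[b]) * ('X_[m'] *: 'X_[b']) = (c *: 'X_[m + m']) *: 'X_[b + b'] :> Rt.
Proof. by rewrite -['X_[m']]scale1r biterm_mul mulr1. Qed.

Lemma mpoly2_mulI P P' : P != 0 -> P * P' = 0 -> P' = 0.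
Proof. by move=> /negbTE P0 /mpoly_idomainAxiom; rewrite P0 => /eqP. Qed.

Lemma bisuppM (Q1 Q2 Q3 : _ -> _ -> bool) P P' :
  (forall b m b' m', Q1 b m -> Q2 b' m' -> Q3 (b + b')%MM (m + m')%MM) ->
  bisupp Q1 P -> bisupp Q2 P' -> bisupp Q3 (P * P').
Proof.
move=> QQ HP HP'; apply: (bisupp_ind (C := fun x => bisupp Q3 (x * P')) HP).
- by rewrite mul0r; exact: bisupp0.
- by move=> x y Hx Hy; rewrite mulrDl; exact: bisuppD.
move=> c b m Qbm; apply: (bisupp_ind (C := fun x => bisupp Q3 (_ * x)) HP').
- by rewrite mulr0; exact: bisupp0.
- by move=> x y Hx Hy; rewrite mulrDr; exact: bisuppD.
by move=> c' b' m' Qbm'; rewrite biterm_mul; apply: bisupp_term; exact: QQ.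
Qed.

(** Together with [bisupp_disjoint], which makes the two parts unique, this replaces a projection
    onto the terms satisfying [Q]. *)
Lemma bisupp_split Q P : exists P0 P1,
  [/\ P = P0 + P1, bisupp Q P0 & bisupp (fun b m => ~~ Q b m) P1].
Proof.
have HP : bisupp (fun _ _ => true) P by [].
apply: (bisupp_ind (C := fun P => exists P0 P1,
  [/\ P = P0 + P1, bisupp Q P0 & bisupp (fun b m => ~~ Q b m) P1]) HP).
- by exists 0, 0; rewrite addr0; split=> //; exact: bisupp0.
- move=> _ _ [x0 [x1 [-> Hx0 Hx1]]] [y0 [y1 [-> Hy0 Hy1]]].
  by exists (x0 + y0), (x1 + y1); split; [rewrite addrACA | exact: bisuppD | exact: bisuppD].
- move=> c b m _; case: (boolP (Q b m)) => Qbm.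
    exists ((c *: 'X_[m]) *: 'X_[b]), 0; rewrite addr0; split=> //.
      exact: bisupp_term.
    exact: bisupp0.
  exists 0, ((c *: 'X_[m]) *: 'X_[b]); rewrite add0r; split=> //.
    exact: bisupp0.
  exact: bisupp_term.
Qed.

Lemma bisupp_disjoint Q P :
  bisupp Q P -> bisupp (fun b m => ~~ Q b m) P -> P = 0.
Proof.
move=> HP HN; apply/mpolyP => b; apply/mpolyP => m; rewrite !mcoeff0.
by apply/eqP; apply/negP => /negP h; have := HN _ _ h; rewrite (HP _ _ h).
Qed.

Lemma bisupp_sum Q (I : Type) (s : seq I) (C : pred I) (F : I -> Rt) :
  (forall i, C i -> bisupp Q (F i)) -> bisupp Q (\sum_(i <- s | C i) F i).
Proof. by move=> HF; elim/big_ind: _ => //; [exact: bisupp0 | exact: bisuppD]. Qed.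

Lemma bisupp_le (Q Q' : _ -> _ -> bool) P :
  (forall b m, Q b m -> Q' b m) -> bisupp Q P -> bisupp Q' P.
Proof. by move=> QQ HP b m /HP /QQ. Qed.

End BigradedSupport.

Section Submonomials.
Variable n : nat.
Implicit Types m : 'X_{1..n}.

Lemma mnm_lt_ex m m' : (mdeg m' <= mdeg m)%N -> m != m' -> exists i, (m' i < m i)%N.
Proof.
move=> md mm; apply/existsP; apply: contraNT mm; rewrite negb_exists => /forallP h.
have le i : (m i <= m' i)%N by rewrite leqNgt; exact: h.
have m'E : m' = (m + (m' - m))%MM by apply/mnmP => i; rewrite mnmDE mnmBE subnKC.
suff d0 : (m' - m)%MM = 0%MM by rewrite m'E d0 addm0.
have := congr1 mdeg m'E; rewrite mdegD => hd; apply/eqP; rewrite -mdeg_eq0; lia.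
Qed.

(** Serves to split off a factor of prescribed degree from a monomial; [m'] is either 1 or the
    variable x_1 that the factor has to retain. *)
Lemma submonomial m' m t : (m' <= m)%MM -> (mdeg m' <= t)%N -> (t <= mdeg m)%N ->
  exists m1, [/\ (m' <= m1)%MM, (m1 <= m)%MM & mdeg m1 = t].
Proof.
move=> le; elim: t => [|t IHt] lt tm.
  by exists m'; split=> //; [exact: lepm_refl | apply/eqP; rewrite -leqn0].
case: (ltngtP (mdeg m') t.+1) lt => // [lt|eq] _; last first.
  by exists m'; split=> //; exact: lepm_refl.
have [m1 [h1 h2 h3]] := IHt lt (ltnW tm).
have [i im] : exists i, (m1 i < m i)%N.
  by apply: mnm_lt_ex; [rewrite h3 ltnW | apply/eqP => mm; move: tm; rewrite mm h3 ltnn].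
exists (m1 + U_(i))%MM; split.
- exact: lepm_trans h1 (lem_addr _ _).
- apply/mnm_lepP => j; rewrite mnmDE mnm1E; case: eqP => [<-|_]; first by rewrite addn1.
  by rewrite addn0; move/mnm_lepP: h2.
- by rewrite mdegD mdeg1 h3 addn1.
Qed.

End Submonomials.

(** * The map from T to F(M) on monomials *)

Section FiberOfM.
Variables (k : fieldType) (n r : nat) (a : 'I_r -> nat).
Local Notation R := {mpoly k[n]}.
Local Notation Rt := {mpoly R[r]}.
Local Notation N := #|{: Tindex n a}|.
Local Notation T := {mpoly k[N]}.

HB.instance Definition _ := GRing.RMorphism.copy (@T_eval k n r a)
  (mmap (@mpolyC r R \o @mpolyC n k)
    (fun v : 'I_N => let u : Tindex n a := enum_val v in 'X_[jmon (tagged u)] *: 'X_(tag u))).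

Definition T_evalR : {rmorphism T -> Rt} := @T_eval k n r a.

Definition var_index (v : 'I_N) : 'I_r := tag (enum_val v : Tindex n a).
Definition var_mon (v : 'I_N) : 'X_{1..n} := jmon (tagged (enum_val v : Tindex n a)).

(** [T_eval] sends monomials to monomials; [tdeg u] and [xdeg u] are the exponents of t and x in the
    image of ['X_[u]]. *)
Definition tdeg (u : 'X_{1..N}) : 'X_{1..r} := (\sum_v U_(var_index v) *+ u v)%MM.
Definition xdeg (u : 'X_{1..N}) : 'X_{1..n} := (\sum_v var_mon v *+ u v)%MM.

Definition wt (b : 'X_{1..r}) : nat := (\sum_l a l * b l)%N.

Lemma T_evalC c : T_eval (c%:MP : T) = c%:MP%:MP.
Proof. by rewrite /T_eval mmapC. Qed.

Lemma T_evalX u : T_eval ('X_[u] : T) = ('X_[xdeg u] : R) *: 'X_[tdeg u].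
Proof.
rewrite /T_eval mmapX /mmap1 -mul_mpolyC.
under eq_bigr do rewrite -/(var_mon _) -/(var_index _) -mul_mpolyC exprMn -rmorphXn.
by rewrite big_split /= -rmorph_prod !mprodXnE.
Qed.

Opaque T_eval.

Lemma T_evalZ c p : T_eval (c *: p : T) = c%:MP *: T_eval p.
Proof. by rewrite -mul_mpolyC rmorphM /= T_evalC mul_mpolyC. Qed.

Lemma T_evalXZ c u : T_eval (c *: 'X_[u] : T) = (c *: 'X_[xdeg u]) *: 'X_[tdeg u].
Proof. by rewrite T_evalZ T_evalX scalerA mul_mpolyC. Qed.

Lemma T_evalE (p : T) :
  T_eval p = \sum_(u <- msupp p) (p@_u *: 'X_[xdeg u]) *: 'X_[tdeg u].
Proof. by rewrite {1}[p]mpolyE raddf_sum; apply: eq_bigr => u _; exact: T_evalXZ. Qed.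

Lemma tdegD u u' : tdeg (u + u') = (tdeg u + tdeg u')%MM.
Proof.
rewrite /tdeg -big_split; apply: eq_bigr => v _ /=.
by apply/mnmP => i; rewrite !(mnmDE, mulmnE) mulnDr.
Qed.

Lemma xdegD u u' : xdeg (u + u') = (xdeg u + xdeg u')%MM.
Proof.
rewrite /xdeg -big_split; apply: eq_bigr => v _ /=.
by apply/mnmP => i; rewrite !(mnmDE, mulmnE) mulnDr.
Qed.

Lemma tdegU v : tdeg U_(v) = U_(var_index v)%MM.
Proof.
rewrite /tdeg (bigD1 v) //= mnm1E eqxx mulm1n big1 ?addm0 // => i /negbTE iv.
by rewrite mnm1E eq_sym iv mulm0n.
Qed.

Lemma xdegU v : xdeg U_(v) = var_mon v.
Proof.
rewrite /xdeg (bigD1 v) //= mnm1E eqxx mulm1n big1 ?addm0 // => i /negbTE iv.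
by rewrite mnm1E eq_sym iv mulm0n.
Qed.

Lemma mdeg_tdeg u : mdeg (tdeg u) = mdeg u.
Proof.
by rewrite mdeg_sum mdegE; apply: eq_bigr => v _; rewrite mdegMn mdeg1 mul1n.
Qed.

Lemma wtD b b' : wt (b + b') = (wt b + wt b')%N.
Proof. by rewrite /wt -big_split; apply: eq_bigr => l _; rewrite mnmDE mulnDr. Qed.

Lemma wtU l : wt U_(l) = a l.
Proof.
rewrite /wt (bigD1 l) //= mnm1E eqxx muln1 big1 ?addn0 // => i /negbTE il.
by rewrite mnm1E eq_sym il muln0.
Qed.

Lemma wt0 : wt 0%MM = 0%N.
Proof. by rewrite /wt big1 // => i _; rewrite mnm0E muln0. Qed.

Lemma mnm_Uind (q : nat) (C : 'X_{1..q} -> Prop) :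
  C 0%MM -> (forall i u, C u -> C (U_(i) + u)%MM) -> forall u, C u.
Proof.
move=> C0 CU u; move eu: (mdeg u) => e; elim: e u eu => [|e IHe] u ue.
  by move/eqP: ue; rewrite mdeg_eq0 => /eqP ->.
have [i ui] : exists i, (0 < u i)%N by apply: mnm_gt0_ex; rewrite ue.
rewrite -(mnm_subU ui); apply/CU/IHe/succn_inj.
by rewrite -ue -{2}(mnm_subU ui) mdegD mdeg1.
Qed.

Hypothesis n_gt0 : (0 < n)%N.

Lemma mdeg_var_mon v : mdeg (var_mon v) = a (var_index v).
Proof. by rewrite /var_mon mdeg_jmon. Qed.

Lemma mdeg_xdeg u : mdeg (xdeg u) = wt (tdeg u).
Proof.
elim/mnm_Uind: u => [|v u IHu].
  by rewrite /xdeg /tdeg !big1 ?mdeg0 ?wt0 // => v _; rewrite mnm0E mulm0n.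
by rewrite xdegD tdegD mdegD wtD IHu xdegU tdegU wtU mdeg_var_mon.
Qed.

Lemma var_ex l m : mdeg m = a l -> exists v, var_index v = l /\ var_mon v = m.
Proof.
move=> /(jmon_surj n_gt0) [j <-].
by exists (enum_rank (existT _ l j : Tindex n a)); rewrite /var_index /var_mon enum_rankK.
Qed.

Lemma var_inj v v' : var_index v = var_index v' -> var_mon v = var_mon v' -> v = v'.
Proof.
rewrite /var_index /var_mon => e1 e2; apply: enum_val_inj; move: e1 e2.
case: (enum_val v) => l j; case: (enum_val v') => l' j' /= ll; move: j'; rewrite -ll => j'.
by move=> /jmon_inj ->.
Qed.

Lemma TvarE l (j : multiindex n (a l)) :
  exists v, [/\ Tvar k j = 'X_v, var_index v = l & var_mon v = jmon j].
Proof.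
by exists (enum_rank (existT _ l j : Tindex n a)); rewrite /var_index /var_mon enum_rankK.
Qed.

Definition weight0 (b : 'X_{1..r}) (m : 'X_{1..n}) : bool := mdeg m == wt b.

Lemma T_eval_weight0 (p : T) : bisupp weight0 (T_eval p).
Proof.
rewrite T_evalE; apply: bisupp_sum => u _; apply: bisupp_term.
by rewrite /weight0 mdeg_xdeg.
Qed.

(** For one factor t_l of t^b at a time, any divisor of x^m of degree a_l may be split off; it gives
    a variable of T. *)
Lemma monomial_ex b m : mdeg m = wt b -> exists u, xdeg u = m /\ tdeg u = b.
Proof.
elim/mnm_Uind: b m => [|l b IHb] m mb.
  exists 0%MM; move/eqP: mb; rewrite wt0 mdeg_eq0 => /eqP ->.
  by rewrite /xdeg /tdeg !big1 // => v _; rewrite mnm0E mulm0n.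
have [m1 [_ m1m m1a]] : exists m1, [/\ (0%MM <= m1)%MM, (m1 <= m)%MM & mdeg m1 = a l].
  apply: submonomial; rewrite ?mdeg0 // ?mb ?wtD ?wtU ?leq_addr //.
  by apply/mnm_lepP => i; rewrite mnm0E.
have [v [vl' vm']] := var_ex m1a.
have [|u [um ub]] := IHb (m - m1)%MM.
  apply/eqP; rewrite -(eqn_add2r (mdeg m1)) -mdegD submK // mb m1a wtD wtU.
  by rewrite addnC.
exists (U_(v) + u)%MM; rewrite xdegD tdegD um ub xdegU tdegU vl' vm'; split=> //.
by rewrite addmC submK.
Qed.

Lemma T_eval_surj P : bisupp weight0 P -> exists p : T, T_eval p = P.
Proof.
move=> HP; apply: (bisupp_ind (C := fun P => exists p : T, T_eval p = P) HP).
- by exists 0; rewrite rmorph0.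
- by move=> _ _ [p <-] [p' <-]; exists (p + p'); rewrite rmorphD.
- move=> c b m /eqP /monomial_ex [u [<- <-]]; exists (c *: 'X_[u]); exact: T_evalXZ.
Qed.

Local Notation I2B := (det_ideal 2 (Bmx k n a)).

Local Notation i0 := (Ordinal n_gt0).

Definition col_index (c : 'I_#|{: Bcol n a}|) : 'I_r := tag (val (enum_val c : Bcol n a)).
Definition col_mon (c : 'I_#|{: Bcol n a}|) : 'X_{1..n} :=
  jmon (tagged (val (enum_val c : Bcol n a))).

Lemma Bmx_entry s c : exists v,
  [/\ Bmx k n a s c = 'X_v, var_index v = col_index c & (U_(i0) + var_mon v = U_(s) + col_mon c)%MM].
Proof.
rewrite mxE /col_index /col_mon; case: (enum_val c) => -[l j] /= jp.
have [v [-> vlE vmE]] := TvarE (jshift j s); exists v; split=> //.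
by rewrite vmE; exact: jmon_shift.
Qed.

Lemma col_ex l m : mdeg m = a l -> (0 < m i0)%N -> exists c, col_index c = l /\ col_mon c = m.
Proof.
move=> /(jmon_surj n_gt0) [j <-] j0.
have jp : multiindex_pos (tagged (existT _ l j : Tindex n a)).
  by rewrite (multiindex_posE _ (i0 := i0)).
exists (enum_rank (Sub (existT _ l j : Tindex n a) jp : Bcol n a)).
by rewrite /col_index /col_mon enum_rankK.
Qed.

End FiberOfM.

Opaque T_eval.

(** * Exchanging variables modulo the minors of B *)

Section KernelOfT_eval.
Variables (k : fieldType) (n r : nat) (a : 'I_r -> nat).
Hypothesis n_gt0 : (0 < n)%N.
Local Notation N := #|{: Tindex n a}|.
Local Notation T := {mpoly k[N]}.
Local Notation I2B := (det_ideal 2 (Bmx k n a)).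
Local Notation i0 := (Ordinal n_gt0).
Local Notation q := (cls I2B).

Lemma det_ideal_T_eval (p : T) : I2B p -> T_eval p = 0.
Proof.
move=> Ip; suff : ker_ideal (T_evalR k n a) p by [].
apply: (det_ideal2_min _ Ip) => s s' c c' {p Ip}.
have [v1 [-> l1 m1]] := Bmx_entry k n_gt0 s c.
have [v2 [-> l2 m2]] := Bmx_entry k n_gt0 s' c'.
have [v3 [-> l3 m3]] := Bmx_entry k n_gt0 s c'.
have [v4 [-> l4 m4]] := Bmx_entry k n_gt0 s' c.
suff : T_eval ('X_v1 * 'X_v2 - 'X_v3 * 'X_v4 : T) = 0 by [].
rewrite -!mpolyXD rmorphB /= !T_evalX !tdegD !xdegD !tdegU !xdegU l1 l2 l3 l4.
rewrite [(U_(col_index c') + _)%MM]addmC.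
suff -> : (var_mon v1 + var_mon v2)%MM = (var_mon v3 + var_mon v4)%MM by rewrite subrr.
apply/mnmP => i; move/mnmP/(_ i): m1; move/mnmP/(_ i): m2; move/mnmP/(_ i): m3.
move/mnmP/(_ i): m4; rewrite !mnmDE; lia.
Qed.

(** Let m1 and m2 be the monomials of [v1] and [v2]. In the columns of x_1 m1 / x_s' and x_1 m2 /
    x_s, these two variables are the entries in rows s' and s. The minor on these rows and columns
    exchanges x_s' and x_s between them. *)
Lemma swap_vars v1 v2 (s s' : 'I_n) : (0 < var_mon v1 s')%N -> (0 < var_mon v2 s)%N ->
  exists v3 v4, [/\ q ('X_v1 * 'X_v2) = q ('X_v3 * 'X_v4), var_index v3 = var_index v1 &
    (U_(s') + var_mon v3 = U_(s) + var_mon v1)%MM].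
Proof.
move=> s1 s2.
have md (v : 'I_N) (t : 'I_n) : (0 < var_mon v t)%N ->
    (mdeg (U_(i0) + (var_mon v - U_(t)))%MM = a (var_index v)).
  by move=> vt; rewrite -(mdeg_var_mon n_gt0 v) -[in RHS](mnm_subU vt) !mdegD !mdeg1.
have U0 m : (0 < (U_(i0) + m)%MM i0)%N by rewrite mnmDE mnm1E eqxx.
have [c [cl1 cm1]] := col_ex (md _ _ s1) (U0 _).
have [c' [cl2 cm2]] := col_ex (md _ _ s2) (U0 _).
have [w1 [E1 l1 m1]] := Bmx_entry k n_gt0 s' c.
have [w2 [E2 l2 m2]] := Bmx_entry k n_gt0 s c'.
have [w3 [E3 l3 m3]] := Bmx_entry k n_gt0 s c.
have [w4 [E4 l4 m4]] := Bmx_entry k n_gt0 s' c'.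
have w1E : w1 = v1.
  apply: var_inj; first by rewrite l1.
  apply/mnmP => i; move/mnmP/(_ i): m1; rewrite cm1 -{2}(mnm_subU s1) !mnmDE; lia.
have w2E : w2 = v2.
  apply: var_inj; first by rewrite l2.
  apply/mnmP => i; move/mnmP/(_ i): m2; rewrite cm2 -{2}(mnm_subU s2) !mnmDE; lia.
exists w3, w4; split.
- apply/clsE; rewrite -w1E -w2E -E1 -E2 -E3 -E4; exact: det_ideal2.
- by rewrite l3.
- apply/mnmP => i; move/mnmP/(_ i): m3; rewrite cm1 -{2}(mnm_subU s1) !mnmDE; lia.
Qed.

Lemma cls_monomial_degs u w : q 'X_[u] = q 'X_[w] -> xdeg u = xdeg w /\ tdeg u = tdeg w.
Proof.
move=> /clsE /det_ideal_T_eval; rewrite rmorphB /= !T_evalX => /eqP; rewrite subr_eq0.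
move=> /eqP E; have := congr1 (fun P => P@_(tdeg u)@_(xdeg u)) E.
rewrite -['X_[xdeg u]]scale1r -['X_[xdeg w]]scale1r !coef_biterm !eqxx !mulr1 mul1r.
case: (xdeg w =P xdeg u) => [-> //|_]; last by rewrite mul0r => /eqP; rewrite oner_eq0.
case: (tdeg w =P tdeg u) => [-> //|_]; last by rewrite mulr0 => /eqP; rewrite oner_eq0.
Qed.

(** Induction on the number of factors, with multiplicity, that the monomial of [v] has and that of
    [v0] lacks. Both monomials have degree a_l, so if x_s is lacking in [v0], some x_s' is in excess
    there; exchanging the two with another variable of the product lowers the number by one. *)
Lemma extract_var v v0 u0 : var_index v = var_index v0 -> (var_mon v <= var_mon v0 + xdeg u0)%MM ->
  exists u', q 'X_[U_(v0) + u0] = q 'X_[U_(v) + u'].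
Proof.
move et: (mdeg (var_mon v - var_mon v0)%MM) => t.
elim: t v0 u0 et => [|t IHt] v0 u0 et vv le.
  suff -> : v = v0 by exists u0.
  apply: var_inj => //; apply/eqP; move/eqP: et; rewrite mdeg_eq0; apply: contraTT => nv.
  have [|i ii] := mnm_lt_ex _ nv; first by rewrite !mdeg_var_mon // vv.
  apply/eqP => /mnmP /(_ i); rewrite mnmBE mnm0E; lia.
have [s ss] : exists s, (var_mon v0 s < var_mon v s)%N.
  have [|s] := @mnm_gt0_ex _ (var_mon v - var_mon v0)%MM; first by rewrite et.
  by rewrite mnmBE subn_gt0 => ss; exists s.
have [s' ss'] : exists s', (var_mon v s' < var_mon v0 s')%N.
  apply: mnm_lt_ex; first by rewrite !mdeg_var_mon // vv.
  by apply/eqP => E; move: ss; rewrite E ltnn.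
(* The lacking x_s must be supplied by the other factors, since the monomial of [v] divides the
   whole image. *)
have [v2 u0v2 v2s] : exists2 v2, (0 < u0 v2)%N & (0 < var_mon v2 s)%N.
  have : (0 < xdeg u0 s)%N by have /mnm_lepP/(_ s) := le; rewrite mnmDE; lia.
  rewrite /xdeg mnm_sumE lt0n sum_nat_eq0 => /forallPn /= [v2].
  by rewrite mulmnE muln_eq0 negb_or => /andP[h1 h2]; exists v2; rewrite lt0n.
have v0s' : (0 < var_mon v0 s')%N by apply: leq_ltn_trans ss'.
have [v3 [v4 [E l3 m3]]] := swap_vars v0s' v2s.
pose u1 := (u0 - U_(v2))%MM.
have E' : q 'X_[U_(v0) + u0] = q 'X_[U_(v3) + (U_(v4) + u1)].
  have -> : 'X_[U_(v0) + u0] = 'X_v0 * 'X_v2 * 'X_[u1] :> T.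
    by rewrite -(mnm_subU u0v2) !mpolyXD mulrA.
  by rewrite [in LHS]rmorphM [X in X * _]E -rmorphM -mulrA -!mpolyXD.
have [|||u' E''] := IHt v3 (U_(v4) + u1)%MM; last by exists u'; rewrite E' E''.
- apply: succn_inj; rewrite -et; transitivity (mdeg (U_(s) + (var_mon v - var_mon v3))%MM).
    by rewrite mdegD mdeg1.
  congr mdeg.
  apply/mnmP => i; move/mnmP/(_ i): m3.
  rewrite !(mnmDE, mnmBE, mnm1E).
  case: (s =P i) => [si|_]; case: (s' =P i) => [s'i|_]; move: ss ss'; rewrite ?si ?s'i; lia.
- by rewrite l3.
- have [+ _] := cls_monomial_degs E'.
  by rewrite xdegD xdegU xdegD xdegU => <-.
Qed.

(** A variable of [w] is made to appear in [u] modulo the minors; the cofactors then have equal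
    images, and induction applies to them. *)
Lemma cls_monomial_eq u w : xdeg u = xdeg w -> tdeg u = tdeg w -> q 'X_[u] = q 'X_[w].
Proof.
elim/mnm_Uind: w u => [|v w IHw] u xu tu.
  suff -> : u = 0%MM by [].
  by apply/eqP; rewrite -mdeg_eq0 -mdeg_tdeg tu mdeg_tdeg mdeg0.
have [v0 uv0 v0v] : exists2 v0, (0 < u v0)%N & var_index v0 = var_index v.
  have : (0 < tdeg u (var_index v))%N by rewrite tu tdegD tdegU mnmDE mnm1E eqxx.
  rewrite /tdeg mnm_sumE lt0n sum_nat_eq0 => /forallPn /= [v0].
  rewrite mulmnE muln_eq0 negb_or mnm1E => /andP[h1 h2]; exists v0; first by rewrite lt0n.
  by apply/eqP; move: h1; rewrite eqb0 negbK.
have [|u' E] := @extract_var v v0 (u - U_(v0))%MM (esym v0v).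
  by rewrite -(xdegU v0) -xdegD mnm_subU // xu xdegD xdegU lem_addr.
rewrite -(mnm_subU uv0) E !mpolyXD !rmorphM; congr (_ * _); rewrite -(mnm_subU uv0) in xu tu.
have [] := cls_monomial_degs E; rewrite xu tu => /esym + /esym.
by rewrite !xdegD !tdegD => /addmI h1 /addmI h2; apply: IHw.
Qed.

(** Induction on the size of the support. The image of the leading monomial u must cancel against
    that of another monomial w of [p], since images of monomials are monomials. Subtracting a
    multiple of ['X_[u] - 'X_[w]] keeps the class and removes u without adding any monomial. *)
Lemma T_eval_ker (p : T) : T_eval p = 0 -> I2B p.
Proof.
rewrite -cls_eq0; have [b] := ubnP (size (msupp p)); elim: b p => // b IHb p sb Tp.
have [->|p0] := eqVneq p 0; first by rewrite rmorph0.
pose u := mlead p; have us : u \in msupp p by exact: mlead_supp.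
have [/hasP [w ws /and3P[wu /eqP xw /eqP tw]]|] :=
    boolP (has (fun w => [&& w != u, xdeg w == xdeg u & tdeg w == tdeg u]) (msupp p)).
  pose p' := p - p@_u *: ('X_[u] - 'X_[w]).
  have clsp : q p = q p'.
    apply/clsE; rewrite opprB addrCA subrr addr0 -mul_mpolyC; apply: idealM; apply/clsE.
    exact: cls_monomial_eq.
  rewrite clsp; apply: IHb; last first.
    by rewrite rmorphB /= Tp T_evalZ rmorphB /= !T_evalX xw tw subrr scaler0 subrr.
  rewrite -ltnS; apply: leq_trans sb; rewrite ltnS (perm_size (perm_to_rem us)) /=.
  rewrite ltnS; apply: uniq_leq_size (msupp_uniq _) _ => x.
  rewrite mcoeff_msupp mcoeffB mcoeffZ mcoeffB !mcoeffX rem_filter ?msupp_uniq // mem_filter /=.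
  have [<-|xu] := eqVneq u x; first by rewrite (negbTE wu) subr0 mulr1 subrr eqxx.
  rewrite mcoeff_msupp.
  have [<-|xw'] := eqVneq w x; first by move: ws; rewrite mcoeff_msupp => ->.
  by rewrite subr0 mulr0 subr0.
rewrite -all_predC => /allP h.
have := congr1 (fun P => P@_(tdeg u)@_(xdeg u)) Tp.
rewrite T_evalE !mcoeff0 (perm_big _ (perm_to_rem us)) big_cons !mcoeffD coef_biterm !eqxx !mulr1.
rewrite [X in X@_(tdeg u)]big_seq.
suff -> : (\sum_(i <- rem u (msupp p) | i \in rem u (msupp p))
     (p@_i *: 'X_[xdeg i]) *: 'X_[tdeg i])@_(tdeg u)@_(xdeg u) = 0.
  by rewrite addr0 => /eqP; rewrite mcoeff_eq0 us.
rewrite !raddf_sum big1 //= => w; rewrite mem_rem_uniq ?msupp_uniq // inE => /andP[wu ws].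
have := h _ ws; rewrite /= wu coef_biterm /= negb_and.
by case/orP => /negbTE ->; rewrite ?mulr0 ?mul0r.
Qed.

End KernelOfT_eval.

(** * The special fiber ring of I *)

Section FiberOfI.
Variables (k : fieldType) (n r : nat).
Local Notation R := {mpoly k[n]}.
Local Notation Rt := {mpoly R[r]}.
Variable f : 'I_r -> R.

Definition evt : {rmorphism Rt -> {poly R}} := mmap (@polyC R) (fun l => f l *: 'X).

Lemma evtX c b : evt (c *: 'X_[b]) = (c *: 'X_[b]).@[f] *: 'X^(mdeg b).
Proof.
rewrite /evt /= mmapZ mmapX /mmap1 mevalZ mevalX -scalerA -mul_polyC; congr (_ * _).
under eq_bigr do rewrite -mul_polyC exprMn -rmorphXn.
by rewrite big_split /= -rmorph_prod mul_polyC prodrXr mdegE.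
Qed.

(** The power of t records the degree in the t_l, so [evt P = 0] says that each homogeneous part of
    P vanishes at f. *)
Lemma evt_coef (P : Rt) e : (evt P)`_e = (pihomog mdeg e P).@[f].
Proof.
apply: (mpoly_term_ind (Q := fun P => (evt P)`_e = (pihomog mdeg e P).@[f])).
- by rewrite rmorph0 coef0 pihomog0 meval0.
- by move=> x y Ex Ey; rewrite rmorphD coefD pihomogD mevalD; exact: (congr2 +%R Ex Ey).
move=> b _; rewrite evtX coefZ coefXn [pihomog _ _ _]linearZ /= pihomogX eq_sym.
by case: eqP => _; rewrite ?mulr1 // mulr0 scaler0 meval0.
Qed.

Lemma evt_ker (P : Rt) : regular_sequence f -> evt P = 0 -> koszul f r P.
Proof.
move=> [reg _] P0; rewrite (pihomog_partitionE (leqnn (msize P))).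
apply: ideal_sum => e _; apply: (forms_koszul _ (leqnn r) (e := e)).
- by move=> i x; exact: reg.
- move=> b Pb; split=> [|i]; last by rewrite leqNgt ltn_ord.
  by have /dhomogP := pihomogP mdeg e P; apply; rewrite mcoeff_msupp.
- by rewrite -evt_coef P0 coef0.
Qed.

Lemma koszul_evt (P : Rt) q : koszul f q P -> evt P = 0.
Proof.
move=> KP; suff : ker_ideal evt P by [].
apply: KP => _ [i [j [_ _ ->]]]; suff : evt (f i *: 'X_j - f j *: 'X_i) = 0 by [].
by rewrite rmorphB /= !evtX !mdeg1 !mevalZ !mevalXU mulrC subrr.
Qed.

Lemma evtC c : evt c%:MP = c%:P.
Proof. by rewrite /evt /= mmapC. Qed.

Opaque evt.

Variables (dd : 'I_r -> nat) (d : nat).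
Hypothesis dd_le : forall l, (dd l <= d)%N.
Hypothesis f_homog : forall l, f l \is (dd l).-homog.
Hypothesis n_gt0 : (0 < n)%N.
Local Notation a := (fun i => (d - dd i)%N).
Local Notation T := {mpoly k[#|{: Tindex n a}|]}.
Local Notation I := (truncation f a).
Local Notation m := (irrelevant k n).

Definition T_to_Rees : {rmorphism T -> {poly R}} := evt \o T_evalR k n a.

Lemma T_to_ReesE p : T_to_Rees p = evt (T_eval p).
Proof. by []. Qed.

Opaque T_to_Rees.

Lemma T_to_ReesC c : T_to_Rees c%:MP = c%:MP%:P.
Proof. by rewrite T_to_ReesE T_evalC evtC. Qed.

Lemma T_to_Rees_var v :
  T_to_Rees 'X_v = ('X_[jmon (tagged (enum_val v : Tindex n a))] * f (tag (enum_val v))) *: 'X.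
Proof.
by rewrite T_to_ReesE T_evalX tdegU xdegU evtX mdeg1 expr1 mevalZ mevalXU.
Qed.

Lemma T_to_Rees_mem p : T_to_Rees p \in subring_gen (rees_gens I).
Proof.
apply: (mpoly_term_ind (Q := fun p => T_to_Rees p \in subring_gen (rees_gens I))).
- by rewrite rmorph0 rpred0.
- by move=> x y hx hy; rewrite rmorphD; exact: rpredD hx hy.
move=> u _; rewrite -mul_mpolyC mpolyXE_id rmorphM rmorph_prod rpredM //.
  by rewrite T_to_ReesC; apply: mem_subring_gen; left; exists (p@_u)%:MP.
apply: rpred_prod => v _; rewrite rmorphXn rpredX //=; rewrite -/T_to_Rees.
rewrite [T_to_Rees _]T_to_Rees_var; apply: mem_subring_gen; right.
have h := @truncation_gen k n r f a _ (tagged (enum_val v : Tindex n a)) n_gt0.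
by exists ('X_[jmon (tagged (enum_val v : Tindex n a))] * f (tag (enum_val v))).
Qed.

Definition T_to_fiberI : {rmorphism T -> fiberI a f} :=
  cls (ideal_gen [set rees_const I c | c in (m : set R)]) \o subring_lift T_to_Rees_mem.

Lemma T_to_fiberI_const c : T_to_fiberI c%:MP = fiberI_const a f c.
Proof.
by rewrite /T_to_fiberI /= /fiberI_const; congr cls; apply: val_inj; rewrite /= -T_to_ReesC.
Qed.

Lemma T_to_fiberI_var l (j : multiindex n (a l)) :
  T_to_fiberI (Tvar k j) = fiberI_var f n_gt0 j.
Proof.
rewrite /T_to_fiberI /= /fiberI_var; congr cls; apply: val_inj => /=.
by rewrite [LHS]T_to_Rees_var enum_rankK.
Qed.

Lemma meval_homog b : ('X_[b] : Rt).@[f] \is (wt dd b).-homog.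
Proof.
elim/mnm_Uind: b => [|l b IHb]; first by rewrite mpolyX0 meval1 wt0 dhomog1.
by rewrite mpolyXD mevalM mevalXU wtD wtU dhomogM.
Qed.

(** Every variable goes to some x^j f_l t, and x^j f_l has degree a_l + d_l = d. *)
Lemma T_to_Rees_homog p e : (T_to_Rees p)`_e \is (d * e).-homog.
Proof.
apply: (mpoly_term_ind (Q := fun p => (T_to_Rees p)`_e \is (d * e).-homog)).
- by rewrite rmorph0 coef0 dhomog0.
- by move=> x y hx hy; rewrite rmorphD coefD; exact: dhomogD hx hy.
move=> u _; rewrite T_to_ReesE T_evalXZ evtX coefZ coefXn.
case: eqP => [->|_]; last by rewrite mulr0 dhomog0.
rewrite mulr1 mevalZ -scalerAl dhomogZ //.
suff -> : (d * mdeg (tdeg u))%N = (wt a (tdeg u) + wt dd (tdeg u))%N.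
  by apply: dhomogM (meval_homog _); rewrite dhomogX; apply/eqP; exact: mdeg_xdeg.
rewrite mdegE big_distrr /wt -big_split; apply: eq_bigr => l _ /=.
by rewrite -mulnDl subnK.
Qed.

Lemma order_geM b c (x y : R) : order_ge b x -> order_ge c y -> order_ge (b + c) (x * y).
Proof.
move=> hx hy w wbc; apply: mcoeffM_eq0 => u v E.
case: (ltnP (mdeg u) b) => [/hx ->|ub]; first by rewrite mul0r.
by rewrite hy ?mulr0 //; move: wbc; rewrite E mdegD; lia.
Qed.

Lemma order_geD b (x y : R) : order_ge b x -> order_ge b y -> order_ge b (x + y).
Proof. by move=> hx hy; rewrite -[x]mul1r; exact: order_geMD. Qed.

Lemma order_ge_sum b (J : Type) (s : seq J) (Q : pred J) (F : J -> R) :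
  (forall i, Q i -> order_ge b (F i)) -> order_ge b (\sum_(i <- s | Q i) F i).
Proof. by move=> HF; elim/big_ind: _ => //; [exact: order_ge0 | exact: order_geD]. Qed.

(** A filtration of R[t]: level 0 contains the Rees algebra, because I has order at least d, and
    level 1 contains its ideal generated by the maximal ideal. *)
Definition order_coefs (b : nat) : set {poly R} := [set x | forall e, order_ge (d * e + b) x`_e].

Lemma order_coefsM b c x y : order_coefs b x -> order_coefs c y -> order_coefs (b + c) (x * y).
Proof.
move=> hx hy e; rewrite coefM; apply: order_ge_sum => i _.
have -> : (d * e + (b + c) = (d * i + b) + (d * (e - i) + c))%N.
  have ie : (i <= e)%N by rewrite -ltnS.
  by rewrite -{1}(subnKC ie) mulnDr; lia.
exact: order_geM.
Qed.

Lemma order_coefsD b x y : order_coefs b x -> order_coefs b y -> order_coefs b (x + y).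
Proof. by move=> hx hy e; rewrite coefD; exact: order_geD. Qed.

Lemma order_coefsN b x : order_coefs b x -> order_coefs b (- x).
Proof. by move=> hx e w we; rewrite coefN mcoeffN hx // oppr0. Qed.

Lemma order_coefsC b c : order_ge b c -> order_coefs b c%:P.
Proof.
move=> hc e; rewrite coefC; case: eqP => [->|_]; last exact: order_ge0.
by rewrite muln0.
Qed.

Lemma truncation_order c : I c -> order_ge d c.
Proof. by move/(truncationE c f_homog dd_le (fun=> erefl))=> []. Qed.

Lemma rees_order (x : rees I) : order_coefs 0 (val x).
Proof.
pose C : {pred {poly R}} := fun y => `[< order_coefs 0 y >].
have C_closed : subring_closed C.
  split=> [|x1 y1 /asboolP h1 /asboolP h2|x1 y1 /asboolP h1 /asboolP h2]; apply/asboolP.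
  - exact: order_coefsC.
  - by apply: order_coefsD => //; exact: order_coefsN.
  - exact: (order_coefsM h1 h2).
have /asboolP /(_ C C_closed) h := valP x; apply/asboolP; apply: h.
move=> _ [[c _ <-]|[c Ic <-]]; apply/asboolP; first exact: order_coefsC.
move=> e; rewrite coefZ coefX addn0; case: eqP => [->|_]; last by rewrite mulr0; exact: order_ge0.
by rewrite muln1 mulr1; exact: truncation_order.
Qed.

(** If the image dies in the special fiber, its coefficient of t^e has order greater than d e; being
    homogeneous of degree d e, it is zero. *)
Lemma T_to_fiberI_ker p : T_to_fiberI p = 0 <-> T_to_Rees p = 0.
Proof.
rewrite /T_to_fiberI /= cls_eq0; split=> [Ip|Ep]; last first.
  have -> : subring_lift T_to_Rees_mem p = 0 by apply: val_inj.
  exact: ideal_set0.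
pose J (x : rees I) := order_coefs 1 (val x).
have J0 : J 0 by move=> e; rewrite coef0; exact: order_ge0.
have JMD c x y : J x -> J y -> J (c * x + y).
  move=> Jx Jy; apply: order_coefsD => //.
  exact: (order_coefsM (rees_order c) Jx).
have {}Ip : order_coefs 1 (T_to_Rees p).
  apply: (Ip (Ideal J0 JMD)) => _ [c mc <-].
  apply: order_coefsC.
  by apply: (irrelevant_pow_order (e := 1)); rewrite -[c]mulr1; apply: sub_ideal_gen;
    exists c, 1; split=> //; apply: sub_ideal_gen.
apply/polyP => e; rewrite coef0; apply/mpolyP => w; rewrite mcoeff0.
have [we|we] := eqVneq (mdeg w) (d * e)%N; first by apply: Ip; rewrite we addn1.
by apply: dhomog_nemf_coeff we; exact: T_to_Rees_homog.
Qed.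

Lemma irrelevant_coef0 (c : R) : c@_0 = 0 -> m c.
Proof.
move=> c0; rewrite [c]mpolyE big_seq; apply: ideal_sum => w.
rewrite mcoeff_msupp -mul_mpolyC => cw; apply: idealM.
have [i wi] : exists i, (0 < w i)%N.
  by apply: mnm_gt0_ex; rewrite lt0n mdeg_eq0; apply: contraNneq cw => ->; rewrite c0.
rewrite -(mnm_subU wi) mpolyXD mulrC; apply: idealM.
by apply: sub_ideal_gen; exists i.
Qed.

Local Notation G := (ideal_gen [set rees_const I c | c in (m : set R)]).

Lemma rees_const_im c : exists p, T_to_fiberI p = cls G (rees_const I c).
Proof.
exists (c@_0)%:MP; rewrite T_to_fiberI_const; apply/esym/clsE.
have -> : rees_const I c - rees_const I (c@_0)%:MP = rees_const I (c - (c@_0)%:MP).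
  by apply: val_inj; rewrite /= polyCB.
apply: sub_ideal_gen; exists (c - (c@_0)%:MP) => //.
by apply: irrelevant_coef0; rewrite mcoeffB mcoeffC eqxx mulr1 subrr.
Qed.

Lemma rees_t_im c (Ic : I c) : exists p, T_to_fiberI p = cls G (rees_t Ic).
Proof.
(* These [c] form an ideal. The membership proof is quantified because [rees_t] takes it as an
   argument. *)
pose S c := exists (Ic : I c) p, T_to_fiberI p = cls G (rees_t Ic).
suff [Ic' [p pE]] : S c by exists p; rewrite pE; congr cls; apply: val_inj.
have S0 : S 0.
  exists (ideal_set0 I), 0; rewrite rmorph0; apply/esym/cls_eq0.
  have -> : rees_t (ideal_set0 I) = 0 by apply: val_inj; rewrite /= scale0r.
  exact: ideal_set0.
have SMD b x y : S x -> S y -> S (b * x + y).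
  move=> [Ix [p pE]] [Iy [p' p'E]]; exists (ideal_setMD b Ix Iy).
  have [pb pbE] := rees_const_im b; exists (pb * p + p').
  rewrite rmorphD rmorphM pbE pE p'E.
  rewrite -rmorphM -rmorphD; congr cls; apply: val_inj => /=.
  by rewrite scalerDl mul_polyC scalerA.
apply: (Ic (Ideal S0 SMD)) => _ [l [g [/irrelevant_pow_order hg ->]]].
rewrite [g]mpolyE mulr_suml big_seq; apply: ideal_sum => w.
rewrite mcoeff_msupp => gw.
(* The terms of g have degree at least a_l: a factor of degree exactly a_l gives a variable of T,
   and the rest acts as a coefficient. *)
have [w1 [_ w1w w1a]] : exists w1, [/\ (0%MM <= w1)%MM, (w1 <= w)%MM & mdeg w1 = a l].
  apply: submonomial; rewrite ?mdeg0 //; first by apply/mnm_lepP => i; rewrite mnm0E.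
  by rewrite leqNgt; apply: contra_neqN gw; exact: hg.
have [j jw] := jmon_surj n_gt0 w1a.
rewrite -(submK w1w) mpolyXD -jw -scalerAl -mul_mpolyC -mulrA; do 2!apply: idealM.
exists (@truncation_gen k n r f a l j n_gt0), (Tvar k j).
exact: T_to_fiberI_var.
Qed.

Lemma T_to_fiberI_surj y : exists p, T_to_fiberI p = y.
Proof.
have [[x hx] <-] := cls_surj y.
pose C : {pred {poly R}} := fun z => `[< exists (hz : z \in subring_gen (rees_gens I)) p,
  T_to_fiberI p = cls G (Subring hz) >].
suff /asboolP [hx' [p pE]] : x \in C by exists p; rewrite pE; congr cls; apply: val_inj.
have /asboolP /(_ C) := hx; apply.
  split=> [|u v /asboolP [hu [p pE]] /asboolP [hv [p' p'E]]|
            u v /asboolP [hu [p pE]] /asboolP [hv [p' p'E]]]; apply/asboolP.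
  - exists (rpred1 _), 1; rewrite rmorph1; congr cls; exact: val_inj.
  - exists (rpredB hu hv), (p - p'); rewrite rmorphB pE p'E -rmorphB.
    by congr cls; apply: val_inj.
  - exists (rpredM hu hv), (p * p'); rewrite rmorphM pE p'E -rmorphM.
    by congr cls; apply: val_inj.
move=> _ [[c _ <-]|[c Ic <-]]; apply/asboolP.
  by have [p pE] := rees_const_im c; exists (valP (rees_const I c)), p;
    rewrite pE; congr cls; apply: val_inj.
by have [p pE] := rees_t_im Ic; exists (valP (rees_t Ic)), p; rewrite pE; congr cls; apply: val_inj.
Qed.

End FiberOfI.

Opaque evt T_to_Rees.

(** * Relations of degree zero and the forms h *)

Section WeightZeroRelations.
Variables (k : fieldType) (n r : nat).
Local Notation R := {mpoly k[n]}.
Local Notation Rt := {mpoly R[r]}.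
Variables (f : 'I_r -> R) (dd : 'I_r -> nat) (d : nat).
Hypothesis dd_le : forall l, (dd l <= d)%N.
Hypothesis f_homog : forall l, f l \is (dd l).-homog.
Hypothesis f_regular : regular_sequence f.
Local Notation a := (fun i => (d - dd i)%N).
Local Notation T := {mpoly k[#|{: Tindex n a}|]}.

(* Degree q - p for the grading in which x_i has degree 1 and t_l degree - a_l;
   the two naturals p and q avoid negative degrees. *)
Definition weight (p q : nat) (b : 'X_{1..r}) (m : 'X_{1..n}) : bool :=
  (mdeg m + p == wt a b + q)%N.

Local Notation koszul_rel i j := (f i *: 'X_j - f j *: 'X_i : Rt).

Lemma bisupp_homog_var e l p q (g : R) : g \is e.-homog -> (e + p = d - dd l + q)%N ->
  bisupp (weight p q) (g *: 'X_l : Rt).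
Proof.
move=> hg E b m; rewrite mcoeffZ mcoeffX.
case: (U_(l)%MM =P b) => [<-|_]; last by rewrite mulr0 mcoeff0 eqxx.
rewrite mulr1 => gm; rewrite /weight wtU -E; apply/eqP; congr (_ + _)%N.
by have /dhomogP := hg; apply; rewrite mcoeff_msupp.
Qed.

Lemma koszul_rel_weight i j : bisupp (weight d (dd i + dd j)) (koszul_rel i j).
Proof.
apply: bisuppD.
  by apply: (bisupp_homog_var (f_homog i)); have := dd_le j; lia.
by apply: bisuppN; apply: (bisupp_homog_var (f_homog j)); have := dd_le i; lia.
Qed.

(** F is homogeneous, so the terms of G outside the degree opposite to that of F contribute nothing
    of degree 0 to G F. *)
Lemma weight0_mul_split (G F P0 P1 : Rt) p q : bisupp (weight p q) F ->
  G * F = P0 + P1 -> bisupp (weight0 a) P0 -> bisupp (fun b m => ~~ weight0 a b m) P1 ->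
  exists G0, bisupp (weight q p) G0 /\ P0 = G0 * F.
Proof.
move=> hF E h0 h1; have [G0 [G1 [GE hG0 hG1]]] := bisupp_split (weight q p) G.
exists G0; split=> //; apply/eqP; rewrite -subr_eq0; apply/eqP.
apply: (@bisupp_disjoint _ _ _ (weight0 a)).
  apply: bisuppD => //; apply: bisuppN; apply: bisuppM hG0 hF => b m b' m'.
  by rewrite /weight /weight0 wtD mdegD; lia.
have -> : P0 - G0 * F = G1 * F - P1.
  by apply/eqP; rewrite subr_eq addrAC -[G1 * F + _]addrC -mulrDl -GE E addrK.
apply: bisuppD; last exact: bisuppN.
apply: bisuppM hG1 hF => b m b' m'.
by rewrite /weight /weight0 wtD mdegD; lia.
Qed.

Hypothesis n_gt0 : (0 < n)%N.

Lemma homog_sum_multiindex e (g : R) : g \is e.-homog ->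
  \sum_(u : multiindex n e) g@_(jmon u) *: 'X_[jmon u] = g.
Proof.
move=> hg; apply/mpolyP => w; rewrite raddf_sum /=.
under eq_bigr do rewrite mcoeffZ mcoeffX.
have [we|we] := eqVneq (mdeg w) e.
  have [j jw] := jmon_surj n_gt0 we; rewrite (bigD1 j) //= jw eqxx mulr1 big1 ?addr0 // => u uj.
  by case: eqP => [uw|_]; [move: uj; rewrite (@jmon_inj _ _ u j) ?eqxx // uw | rewrite mulr0].
rewrite (dhomog_nemf_coeff hg we) big1 // => u _.
by case: eqP => [uw|_]; [move: we; rewrite -uw mdeg_jmon ?eqxx | rewrite mulr0].
Qed.

Lemma T_eval_linear l (g : R) : g \is (a l).-homog ->
  T_eval (\sum_(u : multiindex n (a l)) g@_(jmon u) *: Tvar (a := a) k u) = g *: 'X_l.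
Proof.
move=> hg; rewrite raddf_sum /= -[g in RHS](homog_sum_multiindex hg) scaler_suml.
apply: eq_bigr => u _; have [v [-> vlE vmE]] := TvarE k (a := a) u.
by rewrite T_evalXZ xdegU tdegU vlE vmE.
Qed.

Lemma T_eval_hform i j m : (dd i + dd j + mdeg m = d)%N ->
  T_eval (hform a f i j m) = 'X_[m] *: koszul_rel i j.
Proof.
move=> E; have hm : ('X_[m] : R) \is (mdeg m).-homog by rewrite dhomogX.
rewrite /hform rmorphD rmorphN /= !T_eval_linear.
- by rewrite scalerBr !scalerA addrC.
- by rewrite (_ : a j = mdeg m + dd i)%N; [exact: dhomogM | lia].
- by rewrite (_ : a i = mdeg m + dd j)%N; [exact: dhomogM | lia].
Qed.

Local Notation h := (hforms (a := a) f dd d).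

Lemma hforms_T_to_Rees p : h p -> T_to_Rees f dd d p = 0.
Proof.
move=> [i [j [m [ij E ->]]]]; rewrite T_to_ReesE T_eval_hform //.
by rewrite -mul_mpolyC rmorphM (koszul_evt (koszul_pair (ltn_ord i) (ltn_ord j))) mulr0.
Qed.

Hypothesis large_d : forall i j : 'I_r, (i < j)%N -> (dd i + dd j <= d)%N.

Lemma weight_mul_koszul (i j : 'I_r) G : (i < j)%N -> bisupp (weight (dd i + dd j) d) G ->
  exists2 q, ideal_gen h q & T_eval q = G * koszul_rel i j.
Proof.
move=> ij hG.
apply: (bisupp_ind (C := fun G => exists2 q, ideal_gen h q & T_eval q = G * koszul_rel i j) hG).
- by exists 0; [exact: ideal_set0 | rewrite mul0r rmorph0].
- move=> x y [p hp pE] [q hq qE]; exists (p + q); first exact: idealD.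
  by rewrite rmorphD mulrDl; congr (_ + _).
move=> c b m; rewrite /weight => /eqP E; have dij := large_d ij.
(* [m1] indexes the form h to be used; the remaining factor of the term has degree 0, hence is the
   image of a monomial of T. *)
have [m1 [_ m1m m1d]] : exists m1, [/\ (0%MM <= m1)%MM, (m1 <= m)%MM & mdeg m1 = (d - (dd i + dd j))%N].
  by apply: submonomial; rewrite ?mdeg0 //; [apply/mnm_lepP => l; rewrite mnm0E | lia].
have [|u [ux ut]] := @monomial_ex n r a n_gt0 b (m - m1)%MM.
  by move: (congr1 mdeg (submK m1m)); rewrite mdegD; lia.
exists ((c *: 'X_[u]) * hform a f i j m1).
  by apply: idealM; apply: sub_ideal_gen; exists i, j, m1; split=> //; lia.
rewrite rmorphM /= T_evalXZ T_eval_hform; last by lia.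
rewrite ux ut -scalerAr scalerAl scalerA; congr ((_ *: _) * _).
by rewrite -[in RHS](submK m1m) mpolyXD scalerAl mulrC.
Qed.

(** Only the images of [p] and [q] are compared, which suits both presentations: over F(M) this is
    equality, over T it is equality modulo I_2(B). *)
Lemma T_to_Rees_ker_hforms p : T_to_Rees f dd d p = 0 ->
  exists2 q, ideal_gen h q & T_eval q = T_eval p.
Proof.
rewrite T_to_ReesE => /(evt_ker f_regular) Kp.
(* Speaking of the degree 0 part of every multiple G P, and not of P alone, makes this property
   define an ideal of R[t_1, ..., t_r]; G = 1 is what is wanted in the end. *)
pose J (P : Rt) := forall G P0 P1, G * P = P0 + P1 -> bisupp (weight0 a) P0 ->
  bisupp (fun b m => ~~ weight0 a b m) P1 -> exists2 q, ideal_gen h q & T_eval q = P0.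
have J0 : J 0.
  move=> G P0 P1; rewrite mulr0 => /esym/eqP; rewrite addr_eq0 => /eqP E h0 h1.
  exists 0; first exact: ideal_set0.
  rewrite rmorph0; apply/esym; apply: bisupp_disjoint h0 _.
  by rewrite E; exact: bisuppN.
have JMD c x y : J x -> J y -> J (c * x + y).
  move=> Jx Jy G P0 P1; rewrite mulrDr mulrA => E h0 h1.
  have [A0 [A1 [AE hA0 hA1]]] := bisupp_split (weight0 a) (G * c * x).
  have [B0 [B1 [BE hB0 hB1]]] := bisupp_split (weight0 a) (G * y).
  have [q Iq qE] := Jx _ _ _ AE hA0 hA1; have [q' Iq' q'E] := Jy _ _ _ BE hB0 hB1.
  exists (q + q'); first exact: idealD.
  rewrite rmorphD /= qE q'E; apply/eqP; rewrite -subr_eq0; apply/eqP.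
  apply: (@bisupp_disjoint _ _ _ (weight0 a)).
    by apply: bisuppD; [exact: bisuppD | exact: bisuppN].
  have -> : A0 + B0 - P0 = P1 - (A1 + B1).
    apply/eqP; rewrite subr_eq addrAC eq_sym subr_eq addrACA -AE -BE E.
    by rewrite addrC.
  by apply: bisuppD => //; apply: bisuppN; exact: bisuppD.
have : J (T_eval p).
  apply: (Kp (Ideal J0 JMD)) => _ [i [j [ij _ ->]]] G P0 P1 E h0 h1.
  have [G0 [hG0 ->]] := weight0_mul_split (koszul_rel_weight (i := i) (j := j)) E h0 h1.
  exact: weight_mul_koszul.
move=> /(_ 1 (T_eval p) 0); rewrite mul1r addr0; apply=> //; last exact: bisupp0.
exact: T_eval_weight0.
Qed.

End WeightZeroRelations.

(** * Presentations of the special fiber ring for large d *)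

Section PresentationsOfFiberI.
Variables (k : fieldType) (n r : nat).
Local Notation R := {mpoly k[n]}.
Local Notation Rt := {mpoly R[r]}.
Variables (f : 'I_r -> R) (dd : 'I_r -> nat) (d : nat).
Hypothesis dd_le : forall l, (dd l <= d)%N.
Hypothesis f_homog : forall l, f l \is (dd l).-homog.
Hypothesis f_regular : regular_sequence f.
Hypothesis n_gt0 : (0 < n)%N.
Local Notation a := (fun i => (d - dd i)%N).
Local Notation T := {mpoly k[#|{: Tindex n a}|]}.
Local Notation h := (hforms (a := a) f dd d).
Local Notation I2B := (det_ideal 2 (Bmx k n a)).

Lemma fiberI_alg_iso (Q : comPzRingType) (al : {rmorphism T -> Q}) cQ vQ :
  (forall y, exists p, al p = y) ->
  (forall p, al p = 0 <-> T_to_Rees f dd d p = 0) ->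
  (forall c, al c%:MP = cQ c) ->
  (forall l (j : multiindex n (a l)), al (Tvar (a := a) k j) = vQ l j) ->
  alg_iso_on_vars (a := a) cQ vQ
    (fiberI_const a f) (fun l j => fiberI_var f n_gt0 j).
Proof.
move=> al_surj al_ker al_const al_var.
have [|p|phi [phi_bij phiE]] := surj_same_kernel_iso
    (be := T_to_fiberI f dd d n_gt0) al_surj.
- exact: T_to_fiberI_surj.
- by rewrite al_ker T_to_fiberI_ker.
exists phi; split=> [//|c|l j].
- by rewrite -al_const phiE T_to_fiberI_const.
- by rewrite -al_var phiE T_to_fiberI_var.
Qed.

Definition T_to_fiberMR : {rmorphism T -> fiberM k n a} :=
  subring_lift (g := T_evalR k n a) (@T_eval_subproof k n r a).

Lemma T_to_fiberMR_surj y : exists p, T_to_fiberMR p = y.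
Proof.
case: y => [y hy].
pose C : {pred Rt} := fun z => `[< exists p : T, T_eval p = z >].
suff /asboolP [p pE] : y \in C by exists p; apply: val_inj.
have /asboolP /(_ C) := hy; apply.
  split=> [|u v /asboolP [p <-] /asboolP [p' <-]|u v /asboolP [p <-] /asboolP [p' <-]];
    apply/asboolP.
  - by exists 1; rewrite rmorph1.
  - by exists (p - p'); rewrite rmorphB.
  - by exists (p * p'); rewrite rmorphM.
move=> _ [[c _ <-]|[l [j ->]]]; apply/asboolP.
  by exists c%:MP; exact: T_evalC.
have [v [_ vlE vmE]] := TvarE k (a := a) j.
by exists 'X_v; rewrite T_evalX xdegU tdegU vlE vmE.
Qed.

Lemma T_to_fiberMR_const c : T_to_fiberMR c%:MP = fiberM_const n a c.
Proof. by apply: val_inj; exact: T_evalC. Qed.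

Lemma T_to_fiberMR_var l (j : multiindex n (a l)) :
  T_to_fiberMR (Tvar (a := a) k j) = fiberM_var (a := a) k j.
Proof.
apply: val_inj => /=; have [v [-> vlE vmE]] := TvarE k (a := a) j.
by rewrite T_evalX xdegU tdegU vlE vmE.
Qed.

Hypothesis large_d : forall i j : 'I_r, (i < j)%N -> (dd i + dd j <= d)%N.

Lemma fiberI_quotient_fiberM :
  let hM := ideal_gen [set T_to_fiberM p | p in h] in
  alg_iso_on_vars (a := a) (fun c => cls hM (fiberM_const n a c))
                  (fun l j => cls hM (fiberM_var k j))
                  (fiberI_const a f) (fun l j => fiberI_var f n_gt0 j).
Proof.
move=> hM; apply: (fiberI_alg_iso (al := cls hM \o T_to_fiberMR)) => [y|p|c|l j].
- have [x <-] := cls_surj y; have [p <-] := T_to_fiberMR_surj x.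
  by exists p.
- rewrite /= cls_eq0; split=> [hp|/T_to_Rees_ker_hforms].
    (* Substituting f_l t for t_l is defined on all of R[t_1, ..., t_r], hence restricts to F(M). *)
    pose J := @ker_ideal (fiberM k n a) _ (evt f \o (val : {rmorphism fiberM k n a -> Rt})).
    have : J (T_to_fiberMR p) by apply: hp => _ [q hq <-]; exact: hforms_T_to_Rees hq.
    by move=> Jp; exact: Jp.
  move=> /(_ dd_le f_homog f_regular n_gt0 large_d) [q hq qE].
  have <- : T_to_fiberMR q = T_to_fiberMR p by apply: val_inj; exact: qE.
  suff : preim_ideal T_to_fiberMR hM q by [].
  by apply: hq => x hx; apply: sub_ideal_gen; exists x.
- by rewrite /= T_to_fiberMR_const.
- by rewrite /= T_to_fiberMR_var.
Qed.

Lemma fiberI_quotient_T :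
  let I2Bh := ideal_gen ((I2B : set _) `|` h) in
  alg_iso_on_vars (a := a) (fun c => cls I2Bh c%:MP)
                  (fun l j => cls I2Bh (Tvar k j))
                  (fiberI_const a f) (fun l j => fiberI_var f n_gt0 j).
Proof.
move=> I2Bh; apply: (fiberI_alg_iso (al := cls I2Bh)) => [y|p|//|//].
- exact: cls_surj.
rewrite cls_eq0; split=> [hp|/T_to_Rees_ker_hforms].
  suff : ker_ideal (T_to_Rees f dd d) p by [].
  apply: hp => x [Ix|hx]; last exact: hforms_T_to_Rees hx.
  suff : T_to_Rees f dd d x = 0 by [].
  by rewrite T_to_ReesE (det_ideal_T_eval n_gt0 Ix) rmorph0.
move=> /(_ dd_le f_homog f_regular n_gt0 large_d) [q hq qE].
rewrite -(subrK q p); apply: idealD.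
  have pq : T_eval (p - q) = 0.
    by rewrite rmorphB; apply/eqP; rewrite subr_eq0; apply/eqP; exact: esym qE.
  have Ipq : I2B (p - q) by exact: T_eval_ker pq.
  by apply: sub_ideal_gen; left.
by apply: hq => x hx; apply: sub_ideal_gen; right.
Qed.

End PresentationsOfFiberI.

(** * Symbolic powers of K *)

Section DivisibilityByVariable.
Variables (k : fieldType) (n r : nat) (i0 : 'I_n).
Local Notation R := {mpoly k[n]}.
Local Notation Rt := {mpoly R[r]}.
Implicit Types P G : Rt.

(** Divisibility is taken in R[t_1, ..., t_r]: for P in F(M) and e > 0, a nonzero quotient has
    degree -e and so lies outside F(M). *)
Definition x0_div (e : nat) P : Prop := exists G, P = 'X_[U_(i0) *+ e] *: G.

Lemma scale_monomial_inj (w : 'X_{1..n}) G G' : 'X_[w] *: G = 'X_[w] *: G' -> G = G'.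
Proof.
move=> E; apply/eqP; rewrite -subr_eq0.
have /eqP : 'X_[w] *: (G - G') = 0 by rewrite scalerBr E subrr.
rewrite mscalerI => /orP[/eqP /(congr1 (mcoeff w)) /eqP|//].
by rewrite mcoeffX eqxx mcoeff0 oner_eq0.
Qed.

Definition x0_div_ideal (e : nat) : ideal Rt.
Proof.
apply: (@Ideal _ (x0_div e)); first by exists 0; rewrite scaler0.
move=> c _ _ [G ->] [G' ->]; exists (c * G + G').
by rewrite scalerDr scalerAr.
Defined.

Lemma coef_scale_monomial (w m : 'X_{1..n}) G b : ('X_[w] *: G)@_b@_(w + m) = G@_b@_m.
Proof. by rewrite mcoeffZ mulrC mcoeffMX. Qed.

Lemma bisupp_scale_monomial (Q Q' : 'X_{1..r} -> 'X_{1..n} -> bool) (w : 'X_{1..n}) G :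
  (forall b m, Q b m -> Q' b (w + m)%MM) -> bisupp Q G -> bisupp Q' ('X_[w] *: G).
Proof.
move=> QQ hG; rewrite -[G]mul1r scalerAl -[1]mpolyX0 -['X_[w]]scale1r.
apply: (@bisuppM _ _ _ (fun b m => (b == 0%MM) && (m == w)) Q) hG.
  by move=> b m b' m' /andP[/eqP -> /eqP ->]; rewrite add0m; exact: QQ.
by apply: bisupp_term; rewrite !eqxx.
Qed.

Lemma bisupp_x0_div e P : bisupp (fun _ m => (e <= m i0)%N) P -> x0_div e P.
Proof.
move=> hP; apply: (bisupp_ind (C := x0_div e) hP).
- exact: (ideal_set0 (x0_div_ideal e)).
- by move=> x y; exact: (@idealD _ (x0_div_ideal e)).
move=> c b m em; exists ((c *: 'X_[m - U_(i0) *+ e]) *: 'X_[b]).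
rewrite scalerA -scalerAr -mpolyXD addmC submK //.
by apply/mnm_lepP => i; rewrite mulmnE mnm1E; case: eqP => [<-|_]; rewrite ?mul1n.
Qed.

(** Setting x_1 = 0. Applied to coefficients, its kernel is the set of multiples of x_1, and since
    the target is a domain, x_1 is prime. *)
Definition kill_x0 : {rmorphism R -> R} :=
  mmap (@mpolyC n k) (fun i => if i == i0 then 0 else 'X_i).

Lemma kill_x0X m : kill_x0 'X_[m] = if (0 < m i0)%N then 0 else 'X_[m].
Proof.
rewrite /kill_x0 /= mmapX /mmap1; case: posnP => [m0|m0].
  rewrite mpolyXE_id; apply: eq_bigr => i _.
  by case: eqP => [->|//]; rewrite m0 !expr0.
by rewrite (bigD1 i0) //= eqxx expr0n eqn0Ngt m0 mul0r.
Qed.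

Lemma kill_x0_term (c : k) (b : 'X_{1..r}) m :
  map_mpoly kill_x0 ((c *: 'X_[m]) *: 'X_[b]) =
  if (0 < m i0)%N then 0 else (c *: 'X_[m]) *: 'X_[b].
Proof.
rewrite map_mpolyZ map_mpolyX /= -[c *: _]mul_mpolyC rmorphM /= kill_x0X.
rewrite [X in X * _](_ : _ = c%:MP); last by rewrite /kill_x0 /= mmapC.
by case: ifP; rewrite ?mulr0 ?scale0r.
Qed.

Lemma x0_divP P : x0_div 1 P <-> map_mpoly kill_x0 P = 0.
Proof.
split=> [[G ->]|zP]; first by rewrite map_mpolyZ /= kill_x0X mulm1n mnm1E eqxx scale0r.
have [P0 [P1 [PE h0 h1]]] := bisupp_split (fun _ m => (0 < m i0)%N) P.
have z0 : map_mpoly kill_x0 P0 = 0.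
  apply: (bisupp_ind (C := fun P => map_mpoly kill_x0 P = 0) h0).
  - exact: rmorph0.
  - by move=> x y zx zy; rewrite rmorphD /= zx zy addr0.
  - by move=> c b m m0; rewrite kill_x0_term m0.
have z1 : map_mpoly kill_x0 P1 = P1.
  apply: (bisupp_ind (C := fun P => map_mpoly kill_x0 P = P) h1).
  - exact: rmorph0.
  - by move=> x y zx zy; rewrite rmorphD /= zx zy.
  - by move=> c b m /negbTE m0; rewrite kill_x0_term m0.
have P10 : P1 = 0 by rewrite -z1 -zP PE rmorphD /= z0 add0r.
by rewrite PE P10 addr0; exact: bisupp_x0_div.
Qed.

Lemma x0_div_prime P P' : x0_div 1 (P * P') -> ~ x0_div 1 P -> x0_div 1 P'.
Proof.
by move=> /x0_divP; rewrite rmorphM /= => /mpoly_idomainAxiom /orP[|] /eqP /x0_divP.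
Qed.

Lemma x0_div_cancel e P P' : x0_div e (P * P') -> ~ x0_div 1 P -> x0_div e P'.
Proof.
move=> + nP; elim: e P' => [|e IHe] P' [G GE].
  by exists P'; rewrite mulm0n mpolyX0 scale1r.
have [|G' P'E] := @x0_div_prime P P' _ nP.
  by exists ('X_[U_(i0) *+ e] *: G); rewrite scalerA -mpolyXD GE mulm1n -mulmS.
have [|G'' G'E] := IHe G'.
  exists G; apply: (@scale_monomial_inj (U_(i0) *+ 1)).
  by rewrite scalerAr -P'E GE scalerA -mpolyXD mulm1n -mulmS.
by exists G''; rewrite P'E G'E scalerA -mpolyXD mulm1n -mulmS.
Qed.

Lemma x0_divM e e' P P' : x0_div e P -> x0_div e' P' -> x0_div (e + e') (P * P').
Proof.
move=> [G ->] [G' ->]; exists (G * G').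
by rewrite -scalerAl -scalerAr scalerA -mpolyXD; congr ('X_[_] *: _); apply/mnmP => i;
  rewrite mnmDE !mulmnE mulnDr.
Qed.

Lemma x0_div1_exp e P : ~ x0_div 1 P -> ~ x0_div 1 (P ^+ e).
Proof.
move=> nP; elim: e => [|e IHe]; last by rewrite exprS => /x0_div_prime /(_ nP).
by rewrite expr0 => /x0_divP /eqP; rewrite rmorph1 oner_eq0.
Qed.

End DivisibilityByVariable.

Lemma scale_exp_swap (S : comNzRingType) (V : comAlgType S) (c1 c2 c3 c4 : S) (u v : V) e :
  c1 ^+ e * c2 = c3 * c4 ^+ e -> (c1 *: u) ^+ e * (c2 *: v) = (c3 *: v) * (c4 *: u) ^+ e.
Proof.
by move=> E; rewrite !exprZn -!scalerAl -!scalerAr !scalerA E [u ^+ e * v]mulrC.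
Qed.

Section SymbolicPowersOfK.
Variables (k : fieldType) (n r : nat) (a : 'I_r -> nat).
Local Notation R := {mpoly k[n]}.
Local Notation Rt := {mpoly R[r]}.
Local Notation T := {mpoly k[#|{: Tindex n a}|]}.
Local Notation A := (Aring k n a).
Local Notation I2B := (det_ideal 2 (Bmx k n a)).
Hypothesis n_gt0 : (0 < n)%N.
Local Notation i0 := (Ordinal n_gt0).

(** Identifies A with F(M) inside R[t_1, ..., t_r]; what follows uses only the values of [iota] on
    classes. *)
Lemma Aring_embedding : exists iota : {rmorphism A -> Rt},
  forall p, iota (cls I2B p) = T_eval p.
Proof.
pose iota (x : A) := T_eval (qring_repr x).
have iotaE p : iota (cls I2B p) = T_eval p.
  apply/eqP; rewrite -subr_eq0 -rmorphB; apply/eqP; apply: (det_ideal_T_eval n_gt0).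
  by apply/clsE; exact: qring_reprK.
have iota_zmod : zmod_morphism iota.
  move=> x y; have [p <-] := cls_surj x; have [q <-] := cls_surj y.
  by rewrite -rmorphB !iotaE rmorphB.
have iota_mon : monoid_morphism iota.
  split; first by rewrite -(rmorph1 (cls I2B)) iotaE rmorph1.
  move=> x y; have [p <-] := cls_surj x; have [q <-] := cls_surj y.
  by rewrite -rmorphM !iotaE rmorphM.
pose mz := GRing.isZmodMorphism.Build A Rt iota iota_zmod.
pose mm := GRing.isMonoidMorphism.Build A Rt iota iota_mon.
by exists (HB.pack iota mz mm : {rmorphism A -> Rt}).
Qed.

Variable iota : {rmorphism A -> Rt}.
Hypothesis iotaE : forall p, iota (cls I2B p) = T_eval p.

Lemma iota_inj : injective iota.
Proof.
move=> x y; have [p <-] := cls_surj x; have [q <-] := cls_surj y.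
move=> /eqP; rewrite -subr_eq0 -!rmorphB iotaE => /eqP /(T_eval_ker n_gt0) pq.
exact/clsE.
Qed.

Lemma iota_weight0 x : bisupp (weight0 a) (iota x).
Proof. by have [p <-] := cls_surj x; rewrite iotaE; exact: T_eval_weight0. Qed.

Lemma iota_surj P : bisupp (weight0 a) P -> exists x, iota x = P.
Proof. by case/(T_eval_surj n_gt0) => p <-; exists (cls I2B p); rewrite iotaE. Qed.

Lemma Kideal_var l m : mdeg m = a l -> (0 < m i0)%N ->
  exists x, Kideal k n a x /\ iota x = 'X_[m] *: 'X_l.
Proof.
move=> /(jmon_surj n_gt0) [j <-] mi; exists (cls I2B (Tvar k j)); split.
  by apply: sub_ideal_gen; exists l, j; split=> //; rewrite (multiindex_posE _ (i0 := i0)).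
have [v [-> vlE vmE]] := TvarE k j.
by rewrite iotaE T_evalX xdegU tdegU vlE vmE.
Qed.

(** A term of degree 0 divisible by x_1 is a product of some x^m t_l, where x_1 divides x^m and m
    has degree a_l, with a term of degree 0: a generator of K times an element of A. *)
Lemma Kideal_x0_div x : Kideal k n a x <-> x0_div i0 1 (iota x).
Proof.
split=> [Kx|[G GE]].
  suff : preim_ideal iota (x0_div_ideal k r i0 1) x by [].
  apply: Kx => _ [l [j [jp ->]]]; rewrite (multiindex_posE _ (i0 := i0)) // in jp.
  suff : x0_div i0 1 (iota (cls I2B (Tvar k j))) by [].
  have [v [-> vlE vmE]] := TvarE k j; rewrite iotaE T_evalX xdegU tdegU vmE.
  exists ('X_[jmon j - U_(i0)] *: 'X_[U_(var_index v)]).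
  by rewrite scalerA -mpolyXD mulm1n mnm_subU.
have h : bisupp (fun b m => weight0 a b m && (0 < m i0)%N) (iota x).
  move=> b m bm; rewrite (iota_weight0 bm) /= lt0n; apply: contraNneq bm => m0.
  rewrite GE mcoeffZ mulm1n; apply/eqP/mcoeffM_eq0 => u v uv.
  rewrite mcoeffX; case: eqP => [uE|_]; last by rewrite mul0r.
  by move: m0; rewrite uv -uE mnmDE mnm1E eqxx.
suff [y [Ky /iota_inj <- //]] : exists y, Kideal k n a y /\ iota y = iota x.
apply: (bisupp_ind (C := fun P => exists y, Kideal k n a y /\ iota y = P) h).
- by exists 0; rewrite rmorph0; split=> //; exact: ideal_set0.
- move=> _ _ [y [Ky <-]] [z [Kz <-]]; exists (y + z); rewrite rmorphD; split=> //.
  exact: idealD.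
move=> c b m /andP[/eqP mb m0].
(* The weight of b equals the degree of m, which is positive because x_1 divides x^m. *)
have [l bl al] : exists2 l, (0 < b l)%N & (0 < a l)%N.
  have : wt a b != 0%N.
    by rewrite -mb mdeg_eq0; apply: contraTneq m0 => ->; rewrite mnm0E.
  rewrite /wt sum_nat_eq0 => /forallPn [l]; rewrite muln_eq0 negb_or -!lt0n => /andP[h1 h2].
  by exists l.
have bE := mnm_subU bl.
have wE : wt a b = (a l + wt a (b - U_(l)))%N by rewrite -{1}bE wtD wtU.
have [m1 [im1 m1m m1d]] : exists m1, [/\ (U_(i0) <= m1)%MM, (m1 <= m)%MM & mdeg m1 = a l].
  apply: submonomial; rewrite ?mdeg1 //; first by rewrite lep1mP -lt0n.
  by rewrite mb wE leq_addr.
have [y [Ky yE]] : exists x, Kideal k n a x /\ iota x = 'X_[m1] *: 'X_l.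
  by apply: Kideal_var => //; rewrite lt0n -lep1mP.
have [|u [ux ut]] := @monomial_ex n r a n_gt0 (b - U_(l))%MM (m - m1)%MM.
  by move: (congr1 mdeg (submK m1m)); rewrite mdegD; lia.
exists (cls I2B (c *: 'X_[u]) * y); split; first exact: idealM.
have -> : iota (cls I2B (c *: 'X_[u]) * y) = T_eval (c *: 'X_[u] : T) * ('X_[m1] *: 'X_l).
  by rewrite rmorphM iotaE yE.
by rewrite T_evalXZ ux ut bitermX_mul submK // addmC bE.
Qed.

Lemma ideal_pow_x0_div e x : ideal_pow (Kideal k n a) e x -> x0_div i0 e (iota x).
Proof.
elim: e x => [|e IHe] x Kx; first by exists (iota x); rewrite mulm0n mpolyX0 scale1r.
suff : preim_ideal iota (x0_div_ideal k r i0 e.+1) x by [].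
apply: Kx => _ [y [z [Ky Kz ->]]].
suff : x0_div i0 (1 + e) (iota (y * z)) by [].
by rewrite rmorphM; apply: x0_divM; [exact/Kideal_x0_div | exact: IHe].
Qed.

Lemma ideal_pow_exp (S : comPzRingType) (I : ideal S) e x : I x -> ideal_pow I e (x ^+ e).
Proof.
move=> Ix; elim: e => [|e IHe]; first by apply: sub_ideal_gen.
by rewrite exprS; apply: sub_ideal_gen; exists x, (x ^+ e).
Qed.

Lemma x0_div_weight0 e (P : Rt) : x0_div i0 e P -> bisupp (weight0 a) P ->
  exists G, P = 'X_[U_(i0) *+ e] *: G /\ bisupp (fun b m => (mdeg m + e == wt a b)%N) G.
Proof.
move=> [G ->] hP; exists G; split=> // b m bm.
have := hP b (U_(i0) *+ e + m)%MM; rewrite coef_scale_monomial => /(_ bm).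
by rewrite /weight0 mdegD mdegMn mdeg1 mul1n addnC.
Qed.

Lemma scale_weight0 (i : 'I_n) e (G : Rt) : bisupp (fun b m => (mdeg m + e == wt a b)%N) G ->
  bisupp (weight0 a) ('X_[U_(i) *+ e] *: G).
Proof.
apply: bisupp_scale_monomial => b m.
by rewrite /weight0 mdegD mdegMn mdeg1 mul1n addnC.
Qed.

Hypothesis n_gt1 : (1 < n)%N.
Local Notation i1 := (Ordinal n_gt1).

Lemma x0_swap_monomials (al e : nat) (u v : Rt) : (0 < al)%N ->
  ('X_[U_(i1) *+ al] *: u) ^+ e * ('X_[U_(i0) *+ e] *: v) =
  ('X_[U_(i1) *+ e] *: v) * ('X_[U_(i0) + U_(i1) *+ al.-1] *: u) ^+ e.
Proof.
move=> al0; apply: scale_exp_swap; rewrite !mpolyXn -!mpolyXD; congr 'X_[_].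
apply/mnmP => i; rewrite !(mnmDE, mulmnE).
by case: al al0 => // t _; nia.
Qed.

(* If x is divisible by x_1^e, then s = (x_2^{a_l} t_l)^e moves x into K^e:
   s x = (x_1 x_2^{a_l - 1} t_l)^e x_2^e (x / x_1^e). *)
Lemma symbolic_power_x0_div e x : (0 < e)%N ->
  symbolic_power (Kideal k n a) e x <-> x0_div i0 e (iota x).
Proof.
move=> e0; have K1 : ~ Kideal k n a 1.
  by rewrite Kideal_x0_div rmorph1 => /x0_divP /eqP; rewrite rmorph1 oner_eq0.
split=> [[b [s [u [Kb Ks Ku E]]]]|Dx].
  (* After cancelling u, s x = b with b divisible by x_1^e and s not divisible by x_1. *)
  have u0 : iota u != 0.
    apply: contra_not_neq Ku => u0; suff -> : u = 0 by exact: ideal_set0.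
    by apply: iota_inj; rewrite u0 rmorph0.
  have : iota u * (iota s * iota x - iota b) = 0.
    by rewrite -rmorphM -rmorphB -rmorphM E rmorph0.
  move=> /(mpoly2_mulI u0) /subr0_eq sb.
  apply: (@x0_div_cancel k n r i0 e (iota s)); last by move=> /Kideal_x0_div.
  by rewrite sb; exact: ideal_pow_x0_div.
have [G [GE hG]] := x0_div_weight0 Dx (@iota_weight0 x).
(* If all a_l are 0, every weight is 0 and no term has degree -e with e > 0; then x = 0. *)
have [[l al]|na] := pselect (exists l, (0 < a l)%N); last first.
  have -> : x = 0.
    apply: iota_inj; rewrite rmorph0 GE; suff -> : G = 0 by rewrite scaler0.
    apply/mpolyP => b; apply/mpolyP => m; rewrite !mcoeff0.
    apply/eqP; apply: contra_notT na => /hG; rewrite /wt => /eqP E.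
    have : (\sum_l a l * b l)%N != 0%N by rewrite -E addn_eq0 negb_and -!lt0n e0 orbT.
    rewrite sum_nat_eq0 => /forallPn [l]; rewrite muln_eq0 negb_or -!lt0n => /andP[h1 h2].
    by exists l.
  exists 0, 1, 1; split=> //; first exact: ideal_set0.
  by rewrite mulr0 subr0 mulr0.
have [||kap [Kkap kapE]] := @Kideal_var l (U_(i0) + U_(i1) *+ (a l).-1)%MM.
- by rewrite mdegD mdegMn !mdeg1 mul1n add1n prednK.
- by rewrite mnmDE mnm1E eqxx.
have [sig sigE] : exists sig, iota sig = 'X_[U_(i1) *+ a l] *: 'X_l.
  apply: iota_surj; rewrite -['X_[_ *+ _]]scale1r; apply: bisupp_term.
  by rewrite /weight0 wtU mdegMn mdeg1 mul1n.
have [y yE] := iota_surj (scale_weight0 (i := i1) hG).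
have nsig : ~ x0_div i0 1 (iota sig).
  rewrite sigE => /x0_divP; rewrite map_mpolyZ map_mpolyX /= kill_x0X mulmnE mnm1E mul0n /=.
  move=> /(congr1 (fun P : Rt => P@_U_(l)@_(U_(i1) *+ a l))) /eqP.
  by rewrite mcoeffZ mcoeffX eqxx mulr1 mcoeffX eqxx !mcoeff0 oner_eq0.
exists (y * kap ^+ e), (sig ^+ e), 1; split=> //.
- by apply: idealM; exact: ideal_pow_exp.
- by rewrite Kideal_x0_div rmorphXn; exact: x0_div1_exp.
suff E : sig ^+ e * x = y * kap ^+ e by rewrite E subrr mulr0.
apply: iota_inj.
have -> : iota (sig ^+ e * x) = iota sig ^+ e * iota x by rewrite rmorphM rmorphXn.
have -> : iota (y * kap ^+ e) = iota y * iota kap ^+ e by rewrite rmorphM rmorphXn.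
by rewrite yE GE kapE sigE; exact: x0_swap_monomials.
Qed.

End SymbolicPowersOfK.

(** * Two forms: the kernel as a shifted symbolic power *)

Section TwoForms.
Variables (k : fieldType) (n r : nat).
Local Notation R := {mpoly k[n]}.
Local Notation Rt := {mpoly R[r]}.
Variables (f : 'I_r -> R) (dd : 'I_r -> nat) (d : nat).
Hypothesis dd_le : forall l, (dd l <= d)%N.
Hypothesis f_homog : forall l, f l \is (dd l).-homog.
Hypothesis f_regular : regular_sequence f.
Hypothesis n_gt0 : (0 < n)%N.
Hypothesis n_gt1 : (1 < n)%N.
Local Notation a := (fun i => (d - dd i)%N).
Local Notation T := {mpoly k[#|{: Tindex n a}|]}.
Local Notation A := (Aring k n a).
Local Notation I2B := (det_ideal 2 (Bmx k n a)).
Local Notation K := (Kideal k n a).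
Local Notation i0 := (Ordinal n_gt0).

Lemma pihomog_T_eval e (p : T) : T_eval (pihomog mdeg e p) = pihomog mdeg e (T_eval p).
Proof.
apply: (mpoly_term_ind (Q := fun p : T =>
  T_eval (pihomog mdeg e p) = pihomog mdeg e (T_eval p))).
- by rewrite pihomog0 !rmorph0 pihomog0.
- move=> x y Ex Ey; rewrite pihomogD [LHS]rmorphD [in RHS]rmorphD [RHS]pihomogD.
  exact: (congr2 +%R Ex Ey).
move=> u _; rewrite T_evalXZ [in RHS]linearZ [in LHS]linearZ /= !pihomogX.
have -> : (mdeg (tdeg u) == e) = (mdeg u == e) by rewrite mdeg_tdeg.
by case: ifP => _; rewrite ?scaler0 ?rmorph0 // T_evalXZ.
Qed.

Lemma evt_pihomog e (P : Rt) : evt f P = 0 -> evt f (pihomog mdeg e P) = 0.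
Proof.
move=> P0; apply/polyP => e'; rewrite coef0 evt_coef.
have [<-|ee] := eqVneq e e'; first by rewrite pihomog_id -evt_coef P0 coef0.
by rewrite (pihomog_ne0 ee) ?meval0 //; exact: pihomogP.
Qed.

Variable iota : {rmorphism A -> Rt}.
Hypothesis iotaE : forall p, iota (cls I2B p) = T_eval p.

(** Each variable of T maps to a term of degree 1 in the t_l, so the grading of A becomes the degree
    in t. *)
Lemma A_deg_iota e x : A_deg e x <-> iota x \is e.-homog.
Proof.
have [p <-] := cls_surj x; rewrite iotaE; split=> [[q hq /clsE qp]|hp].
  have -> : T_eval p = T_eval q.
    apply/esym/eqP; rewrite -subr_eq0 -rmorphB; apply/eqP; exact: det_ideal_T_eval qp.
  by move: hq; rewrite /= !homog_piE -pihomog_T_eval => /eqP ->.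
exists (pihomog mdeg e p); first exact: pihomogP.
apply: (iota_inj n_gt0 iotaE); rewrite !iotaE pihomog_T_eval.
by apply/eqP; rewrite -homog_piE.
Qed.

Lemma homogeneous_sub_iota (N : set A) (C : Rt -> Prop) :
  (forall x, N x <-> C (iota x)) ->
  (forall e P, C P -> C (pihomog mdeg e P)) ->
  homogeneous_sub (A_deg (a := a)) N.
Proof.
move=> NC Cpi x; have [p <-] := cls_surj x => Np.
exists (msize p), (fun e => cls I2B (pihomog mdeg e p)); split=> [e|].
  split; first by exists (pihomog mdeg e p) => //; exact: pihomogP.
  by apply/NC; rewrite iotaE pihomog_T_eval -iotaE; apply/Cpi/NC.
by rewrite -rmorph_sum {1}[p](pihomog_partitionE (leqnn (msize p))).
Qed.

Lemma x0_div_pihomog e e' (P : Rt) : x0_div i0 e P -> x0_div i0 e (pihomog mdeg e' P).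
Proof. by move=> [G ->]; exists (pihomog mdeg e' G); rewrite [LHS]linearZ. Qed.

Variables o0 o1 : 'I_r.
Hypothesis (o0E : o0 = 0%N :> nat) (o1E : o1 = 1%N :> nat) (r2 : r = 2%N).
Hypothesis small_d : (d < dd o0 + dd o1)%N.
Local Notation delta := (dd o0 + dd o1 - d)%N.
Local Notation F := (f o0 *: 'X_o1 - f o1 *: 'X_o0 : Rt).

Lemma koszul2 (P : Rt) : koszul f r P -> exists G, P = G * F.
Proof.
pose J (P : Rt) := exists G, P = G * F.
have J0 : J 0 by exists 0; rewrite mul0r.
have JMD c x y : J x -> J y -> J (c * x + y).
  by move=> [G ->] [G' ->]; exists (c * G + G'); rewrite mulrDl mulrA.
apply: (_ : koszul f r P -> Ideal J0 JMD P) => Kp; apply: Kp.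
move=> _ [i [j [ij jr ->]]]; have io : i = o0 by apply: val_inj => /=; lia.
have jo : j = o1 by apply: val_inj => /=; lia.
by rewrite io jo; exists 1; rewrite mul1r.
Qed.

(** The first element is a nonzerodivisor modulo the ideal generated by the empty set; if it were 0,
    that ideal would contain 1. *)
Lemma f0_neq0 : f o0 != 0.
Proof.
have [reg _] := f_regular; apply/eqP => f0.
have h : ideal_gen [set f j | j in [set j : 'I_r | (j < o0)%N]] 1.
  by apply: (reg o0 1); rewrite f0 mulr0; exact: ideal_set0.
have : ker_ideal (idfun : {rmorphism R -> R}) 1 by apply: h => x [j /=]; rewrite o0E.
by move=> /eqP; rewrite oner_eq0.
Qed.

Lemma F_neq0 : F != 0.
Proof.
apply: contraNneq f0_neq0 => /(congr1 (mcoeff U_(o1))).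
rewrite mcoeffB !mcoeffZ !mcoeffXU mcoeff0 eqxx mulr1.
by rewrite -val_eqE /= o0E o1E mulr0 subr0 => ->.
Qed.

Lemma F_homog : F \is 1.-homog.
Proof. have hX l : ('X_l : Rt) \is 1.-homog by rewrite dhomogX; apply/eqP; exact: mdeg1.
by apply: rpredB; apply: dhomogZ. Qed.

Lemma weight_delta b (m : 'X_{1..n}) : weight dd d (dd o0 + dd o1) d b m = (mdeg m + delta == wt a b)%N.
Proof. by rewrite /weight; apply/eqP/eqP; lia. Qed.

Definition K_kernel : ideal A := preim_ideal iota (ker_ideal (evt f)).

Lemma K_kernelP y : K_kernel y <-> exists G,
  iota y = F * G /\ bisupp (fun b m => (mdeg m + delta == wt a b)%N) G.
Proof.
split=> [/(evt_ker f_regular) /koszul2 [G GE]|[G [yE _]]].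
  (* The image of y has degree 0, so G may be replaced by its part of degree -delta. *)
  have [|||G0 [hG0 yE]] := weight0_mul_split (P0 := iota y) (P1 := 0)
      (@koszul_rel_weight k n r f dd d dd_le f_homog o0 o1) (G := G).
  - by rewrite addr0 GE.
  - exact: iota_weight0.
  - exact: bisupp0.
  exists G0; rewrite yE mulrC; split=> //.
  by apply: bisupp_le hG0 => b m; rewrite weight_delta.
suff : evt f (iota y) = 0 by [].
by rewrite yE rmorphM /= (koszul_evt (koszul_pair (ltn_ord o0) (ltn_ord o1))) mul0r.
Qed.

Lemma F_mul_weight0 (G : Rt) : bisupp (fun b m => (mdeg m + delta == wt a b)%N) G ->
  bisupp (weight0 a) (F * G).
Proof.
move=> hG; apply: bisuppM (@koszul_rel_weight k n r f dd d dd_le f_homog o0 o1) hG.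
by move=> b m b' m'; rewrite /weight /weight0 wtD mdegD; lia.
Qed.

(* x_1^delta G |-> F G *)
Lemma symbolic_power_iso_kernel :
  graded_shift_iso (A_deg (a := a)) 1 (symbolic_power K delta) K_kernel.
Proof.
have delta0 : (0 < delta)%N by lia.
have NE x := symbolic_power_x0_div n_gt0 iotaE n_gt1 x delta0.
have winj := @scale_monomial_inj k n r (U_(i0) *+ delta).
have inj := iota_inj n_gt0 iotaE.
have FI (G G' : Rt) : F * G = F * G' -> G = G'.
  by move=> E; apply/subr0_eq/(mpoly2_mulI F_neq0); rewrite mulrBr E subrr.
split.
- by apply: (homogeneous_sub_iota NE) => e P; exact: x0_div_pihomog.
- apply: (homogeneous_sub_iota (C := fun P => evt f P = 0)) => [x|]; first by [].
  exact: evt_pihomog.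
(* The isomorphism is extracted by choice from its graph. Outside the symbolic power the implication
   is vacuous and the value arbitrary. *)
pose graph (x y : A) := symbolic_power K delta x ->
  exists G, iota x = 'X_[U_(i0) *+ delta] *: G /\ iota y = F * G /\
    bisupp (fun b m => (mdeg m + delta == wt a b)%N) G.
have graph_total x : exists y, graph x y.
  have [Nx|Nx] := pselect (symbolic_power K delta x); last by exists 0.
  have /NE/x0_div_weight0 := Nx; move=> /(_ a (@iota_weight0 _ _ _ _ n_gt0 _ iotaE x)) [G [GE hG]].
  have [y yE] := iota_surj n_gt0 iotaE (F_mul_weight0 hG).
  by exists y => _; exists G.
have [psi psiE] := choice graph_total.
have ND c x y : symbolic_power K delta x -> symbolic_power K delta y ->
    symbolic_power K delta (c * x + y).
  rewrite !NE rmorphD rmorphM; exact: (ideal_setMD (i := x0_div_ideal k r i0 delta)).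
exists psi; split.
- split=> [x /psiE [G [_ [yE hG]]]|x y|y /K_kernelP [G [yE hG]]].
  + by apply/K_kernelP; exists G.
  + move=> /set_mem /psiE [G [xE [pxE _]]] /set_mem /psiE [G' [yE [pyE _]]] pp.
    have E : F * G = iota (psi y) by apply: (etrans (esym pxE)); rewrite pp.
    have GG : G = G' by apply: FI; exact: etrans E pyE.
    by apply: inj; apply: (etrans xE); rewrite GG; exact: esym yE.
  + have [x xE] := iota_surj n_gt0 iotaE (scale_weight0 (i := i0) hG).
    have Nx : symbolic_power K delta x by apply/NE; exists G.
    exists x => //; have [G' [xE' [pxE _]]] := psiE _ Nx.
    have GG : G' = G by apply: winj; exact: etrans (esym xE') xE.
    by apply: inj; apply: (etrans pxE); rewrite GG; exact: esym yE.
- move=> c x y Nx Ny; have [G [xE [pxE _]]] := psiE _ Nx; have [G' [yE [pyE _]]] := psiE _ Ny.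
  have [G'' [zE [pzE _]]] := psiE _ (ND c _ _ Nx Ny).
  (* x_1^delta can be cancelled, so the cofactor depends linearly on the argument. *)
  have GG : G'' = iota c * G + G'.
    apply: winj; apply: (etrans (esym zE)).
    by rewrite rmorphD rmorphM xE yE scalerDr scalerAr.
  apply: inj; apply: (etrans pzE); rewrite GG rmorphD rmorphM pxE pyE.
  by rewrite mulrDr mulrCA.
- move=> e x Nx /A_deg_iota hx; have [G [xE [pxE _]]] := psiE _ Nx.
  (* x_1^delta has degree 0 in t, so G has the degree of x, and multiplication by F adds 1. *)
  apply/A_deg_iota; rewrite pxE addnC; apply: dhomogM F_homog _.
  rewrite homog_piE; apply/eqP; apply: winj; rewrite -xE.
  by apply/eqP; move: hx; rewrite homog_piE {1}xE [pihomog _ _ _]linearZ.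
Qed.

Lemma fiberI_quotient_A :
  alg_iso_on_vars (a := a) (fun c => cls K_kernel (cls I2B c%:MP))
                  (fun l j => cls K_kernel (cls I2B (Tvar k j)))
                  (fiberI_const a f) (fun l j => fiberI_var f n_gt0 j).
Proof.
apply: (fiberI_alg_iso dd_le f_homog n_gt0 (al := cls K_kernel \o cls I2B)) => [y|p|//|//].
  by have [x <-] := cls_surj y; have [p <-] := cls_surj x; exists p.
rewrite /= cls_eq0 T_to_ReesE -iotaE; split=> [h|h]; exact: h.
Qed.

End TwoForms.

Theorem corollary3p12 (k : fieldType) (n r : nat)
    (r_ge2 : (2 <= r)%N) (r_le_n : (r <= n)%N)
    (f : 'I_r -> {mpoly k[n]}) (dd : 'I_r -> nat)
    (dd_mono : forall i j : 'I_r, (i <= j)%N -> (dd j <= dd i)%N)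
    (f_homog : forall i, f i \is (dd i).-homog)
    (f_regular : regular_sequence f) (d : nat) :
  let n_gt0 : (0 < n)%N := leq_trans (ltnW r_ge2) r_le_n in
  let d1 := dd (Ordinal (ltnW r_ge2)) in
  let d2 := dd (Ordinal r_ge2) in
  let a := fun i => (d - dd i)%N in
  let I2B := det_ideal 2 (Bmx k n a) in
  (d1 <= d)%N ->
  ((d1 + d2 <= d)%N ->
     let h := hforms (a := a) f dd d in
     let hM := ideal_gen [set T_to_fiberM p | p in h] in
     let I2Bh := ideal_gen ((I2B : set _) `|` h) in
     alg_iso_on_vars (a := a) (fun c => cls hM (fiberM_const n a c))
                     (fun l j => cls hM (fiberM_var k j))
                     (fiberI_const a f) (fun l j => fiberI_var f n_gt0 j) /\
     alg_iso_on_vars (a := a) (fun c => cls I2Bh c%:MP)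
                     (fun l j => cls I2Bh (Tvar k j))
                     (fiberI_const a f) (fun l j => fiberI_var f n_gt0 j)) /\
  (r = 2%N -> (d < d1 + d2)%N ->
     let delta := (d1 + d2 - d)%N in
     exists KK : ideal (Aring k n a),
       alg_iso_on_vars (a := a) (fun c => cls KK (cls I2B c%:MP))
                       (fun l j => cls KK (cls I2B (Tvar k j)))
                       (fiberI_const a f) (fun l j => fiberI_var f n_gt0 j) /\
       graded_shift_iso (A_deg (a := a)) 1
         (symbolic_power (Kideal k n a) delta) KK).
Proof.
move=> n_gt0 d1 d2 a I2B d1_le.
have dd_le l : (dd l <= d)%N by apply: leq_trans d1_le; exact: dd_mono.
split=> [d12_le|r2 d_lt].
  (* The degrees decrease and j is at least the second index, so d_1 + d_2 bounds every such sum. *)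
  have large_d (i j : 'I_r) : (i < j)%N -> (dd i + dd j <= d)%N.
    by move=> ij; apply: leq_trans d12_le; apply: leq_add; apply: dd_mono => //=; lia.
  by split; [exact: fiberI_quotient_fiberM | exact: fiberI_quotient_T].
have n_gt1 : (1 < n)%N := leq_trans r_ge2 r_le_n.
have [iota iotaE] := Aring_embedding k a n_gt0.
exists (K_kernel f iota); split.
  exact: fiberI_quotient_A.
exact: symbolic_power_iso_kernel.
Qed.
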